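(* Let $T$ be a locally finite simplicial tree, let $A,B\in\mathrm{Isom}(T)$, and let $G=\langle A,B\rangle\le\mathrm{Isom}(T)$. Consider the following procedure, where $l(\cdot)$ denotes translation length (and a method of computing translation lengths is assumed to be given). (1) Set $X=A$, $Y=B$. If $l(X)=0$ or $l(Y)=0$ then return false. (2) If $l(X)>l(Y)$ then swap $X$ and $Y$. (3) Compute $m=\min\{l(XY),l(X^{-1}Y)\}$. (4) If $m=0$ then return false. (5) If $m\le l(Y)-l(X)$ then replace $Y$ by an element of $\{XY,X^{-1}Y\}$ which has translation length $m$ and return to step (2). (6) Otherwise return true and the pair $(X,Y)$. Then for all $A,B\in\mathrm{Isom}(T)$ the procedure terminates after finitely many steps. If $G$ is discrete (with respect to the topology of pointwise convergence) and free of rank two, then it returns true together with a pair $(X,Y)$ which generates $G$ and satisfies the hypotheses of the Ping Pong Lemma for the action on $T$; that is, there exist non-empty closed pairwise disjoint subsets $U_+,U_-,V_+,V_-$ of $T$, which do not cover $T$, such that $X(T\setminus U_-)\subseteq U_+$, $X^{-1}(T\setminus U_+)\subseteq U_-$, $Y(T\setminus V_-)\subseteq V_+$ and $Y^{-1}(T\setminus V_+)\subseteq V_-$. If $G$ is not both discrete and free of rank two, then it returns false.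
   Context: A simplicial tree $T$ is regarded as a metric space (geometric realisation with edges of length one and path metric $d$). $\mathrm{Isom}(T)$ denotes the group of isometries of $T$ as a simplicial tree (mapping vertices to vertices), with the topology of pointwise convergence: $f_i\to f$ if and only if $f_i(x)\to f(x)$ for every $x\in T$. A subgroup is discrete if its subspace topology is discrete. An isometry acts without inversions if it does not swap two adjacent vertices. Let $T^*=T$ if every element of $\mathrm{Isom}(T)$ acts on $T$ without inversions, and otherwise let $T^*$ be the tree obtained from $T$ by subdividing each edge at its midpoint (each new edge again being given length one); $\mathrm{Isom}(T)$ acts on $T^*$ without inversions. Translation lengths are computed in $T^*$: $l(g)=\min_{x\in V(T^* )}d_{T^*}(x,gx)$. *)

(* Defs.v *)
From HB Require Import structures.
From Stdlib Require Import Relation_Operators.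
From mathcomp Require Import all_boot all_order all_algebra.
From mathcomp Require Import all_classical all_reals all_analysis.

Set Implicit Arguments.
Unset Strict Implicit.
Unset Printing Implicit Defensive.

Import Order.TTheory GRing.Theory Num.Theory.
Import numFieldNormedType.Exports.

Local Open Scope classical_set_scope.
Local Open Scope ring_scope.

Record simplicial_tree := SimplicialTree {
  vertex :> choiceType;
  adj : rel vertex;
  adj_sym : symmetric adj;
  adj_irr : irreflexive adj;
  tree_inhabited : inhabited vertex;
  tree_connected : forall u v, exists2 p, path adj u p & last u p = v;
  (* a cycle of size 2 is an edge traversed back and forth *)
  tree_acyclic : forall c, ucycle adj c -> (size c <= 2)%N
}.

Definition locally_finite (T : simplicial_tree) :=
  forall v : T, finite_set [set w | adj v w].

Definition is_simplex (T : simplicial_tree) (u v : T) := (u == v) || adj u v.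

Definition carried (R : realType) (T : simplicial_tree) (u v : T)
    (f : T -> R) := forall w, f w != 0 -> w = u \/ w = v.

(* Points of the geometric realisation are given by barycentric coordinates. *)
Record realization (R : realType) (T : simplicial_tree) := Point {
  coord :> T -> R;
  coord_ge0 : forall v, 0 <= coord v;
  coord_carried : exists u v, is_simplex u v /\ carried u v coord;
  coord_sum : \sum_(v \in [set: T]) coord v = 1
}.

Section Realization.
Context {R : realType} {T : simplicial_tree}.
Local Notation X := (realization R T).
Implicit Types (u v w : T) (r s : R).

Lemma realization_eq (x y : X) : x =1 y -> x = y.
Proof.
case: x y => [x x1 x2 x3] [y y1 y2 y3] /= /funext exy; subst y.
by congr Point; exact: Prop_irrelevance.
Qed.

HB.instance Definition _ := gen_eqMixin X.
HB.instance Definition _ := gen_choiceMixin X.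

Implicit Types x y z : X.

(* [edge_path x y r]: x and y are joined by a concatenation of segments, each
   in a closed edge, of total length r. In a closed edge uv, which has length
   one, the segment from x to y has length |x u - y u|. *)
Inductive edge_path : X -> X -> R -> Prop :=
| edge_path_nil x : edge_path x x 0
| edge_path_cons u v x y z r :
    is_simplex u v -> carried u v x -> carried u v y -> edge_path y z r ->
    edge_path x z (`|x u - y u| + r).

Definition path_dist (x y : X) : R := inf [set r | edge_path x y r].

Lemma edge_path_ge0 x y r : edge_path x y r -> 0 <= r.
Proof. by elim=> // *; rewrite addr_ge0. Qed.

Lemma edge_path_cat x y z r s :
  edge_path x y r -> edge_path y z s -> edge_path x z (r + s).
Proof.
move=> xy; elim: xy z s => {x y r} [x|u v x y t r suv xu yu _ IH] z s.
  by rewrite add0r.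
by move=> /IH h; rewrite -addrA; exact: (edge_path_cons suv xu yu h).
Qed.

Lemma edge_path1 u v x y : is_simplex u v -> carried u v x -> carried u v y ->
  edge_path x y `|x u - y u|.
Proof.
move=> suv xu yu; rewrite -[X in edge_path _ _ X]addr0.
by exact: edge_path_cons suv xu yu (edge_path_nil y).
Qed.

Lemma carried_sum u v x : carried u v x ->
  x u + (if u == v then 0 else x v) = 1.
Proof.
move=> xuv; rewrite -(coord_sum x) (fsbigE (undup [:: u; v])) ?undup_uniq //;
  last first.
  move=> w _; rewrite mem_undup !inE => /norP[wu wv].
  apply/eqP; apply: contraT => /xuv[/eqP|/eqP].
    by rewrite (negPf wu).
  by rewrite (negPf wv).
by rewrite /= inE; case: eqVneq => [->|_];
  rewrite !big_cons big_nil !in_setT ?addr0.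
Qed.

Lemma segment_coord u v x y w :
  is_simplex u v -> carried u v x -> carried u v y ->
  `|x w - y w| <= `|x u - y u|.
Proof.
move=> suv xuv yuv.
have := carried_sum xuv; have := carried_sum yuv.
have [->|wu] := eqVneq w u; first by [].
have [->|wv] := eqVneq w v.
  case: eqP => [->//|_] ey ex.
  have -> : x v = 1 - x u by rewrite -ex addrC addKr.
  have -> : y v = 1 - y u by rewrite -ey addrC addKr.
  by rewrite opprB addrC addrA subrK distrC.
move=> _ _.
have z0 (z : X) : carried u v z -> z w = 0.
  move=> zuv; apply/eqP/negP => /negP w0.
  by have [/eqP|/eqP] := zuv w w0; [rewrite (negPf wu)|rewrite (negPf wv)].
by rewrite !z0 // subrr normr0.
Qed.

Lemma edge_path_sym x y r : edge_path x y r -> edge_path y x r.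
Proof.
elim=> {x y r} [x|u v x y z r suv xuv yuv _ IH]; first exact: edge_path_nil.
by rewrite addrC distrC; apply: edge_path_cat IH _; exact: (@edge_path1 u v).
Qed.

Lemma edge_path_coord x y r w : edge_path x y r -> `|x w - y w| <= r.
Proof.
elim=> {x y r} [x|u v x y z r suv xuv yuv _ IH]; first by rewrite subrr normr0.
rewrite -(subrKA (y w)) (le_trans (ler_normD _ _))// lerD//.
exact: (segment_coord w suv xuv yuv).
Qed.

Definition vcoord v w : R := (w == v)%:R.

Lemma vcoord_ge0 v w : 0 <= vcoord v w. Proof. exact: ler0n. Qed.

Lemma vcoord_supp v w : vcoord v w != 0 -> w = v.
Proof. by rewrite /vcoord; case: (eqVneq w v) => // _; rewrite eqxx. Qed.

Lemma vcoord_carried v :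
  exists u u', is_simplex u u' /\ carried u u' (vcoord v).
Proof.
exists v, v; split; first by rewrite /is_simplex eqxx.
by move=> w /vcoord_supp ->; left.
Qed.

Lemma vcoord_sum v : \sum_(w \in [set: T]) vcoord v w = 1.
Proof.
rewrite -(fsbig_widen [set v])//; first by rewrite fsbig_set1 /vcoord eqxx.
by move=> w [_ wv] /=; rewrite /vcoord; case: eqP.
Qed.

Definition vpoint v : X :=
  Point (vcoord_ge0 v) (vcoord_carried v) (vcoord_sum v).

Lemma vpoint_carriedl u v : carried u v (vpoint u).
Proof. by move=> w /vcoord_supp ->; left. Qed.

Lemma vpoint_carriedr u v : carried u v (vpoint v).
Proof. by move=> w /vcoord_supp ->; right. Qed.

Lemma edge_path_ex x y : exists r, edge_path x y r.
Proof.
have [u [u' [suu' xu]]] := coord_carried x.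
have [v [v' [svv' yv]]] := coord_carried y.
have [p pp lp] := tree_connected u v.
have [r hr] : exists r, edge_path (vpoint u) (vpoint v) r.
  rewrite -lp; elim: p u {suu' xu lp} pp => [|a p IH] u /=.
    by exists 0; exact: edge_path_nil.
  move=> /andP[ua /IH[r hr]]; eexists.
  apply: (@edge_path_cons u a) hr; first by rewrite /is_simplex ua orbT.
    exact: vpoint_carriedl.
  exact: vpoint_carriedr.
have xr := edge_path1 suu' xu (@vpoint_carriedl u u').
have yr := edge_path1 svv' (@vpoint_carriedl v v') yv.
by eexists; exact: edge_path_cat (edge_path_cat xr hr) yr.
Qed.

Lemma edge_path_has_inf x y : has_inf [set r | edge_path x y r].
Proof.
split; first by have [r ?] := edge_path_ex x y; exists r.
by exists 0 => r /edge_path_ge0.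
Qed.

Lemma path_dist_le x y r : edge_path x y r -> path_dist x y <= r.
Proof. by move=> h; apply: ge_inf => //; exact: (edge_path_has_inf x y).2. Qed.

Lemma path_dist_ge x y s :
  (forall r, edge_path x y r -> s <= r) -> s <= path_dist x y.
Proof. by move=> h; apply: lb_le_inf => //; exact: (edge_path_has_inf x y).1. Qed.

Lemma path_distxx x : path_dist x x = 0.
Proof.
apply/eqP; rewrite eq_le (path_dist_le (edge_path_nil x)) /=.
by apply: path_dist_ge => r /edge_path_ge0.
Qed.

Lemma path_dist_positivity x y : path_dist x y = 0 -> x = y.
Proof.
move=> d0; apply: realization_eq => w.
apply/eqP; rewrite -subr_eq0 -normr_le0 -d0.
by apply: path_dist_ge => r; exact: edge_path_coord.
Qed.

Lemma path_dist_sym x y : path_dist x y = path_dist y x.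
Proof.
by congr inf; apply/seteqP; split=> r; exact: edge_path_sym.
Qed.

Lemma path_dist_triangle y x z :
  path_dist x z <= path_dist x y + path_dist y z.
Proof.
rewrite -lerBlDr; apply: path_dist_ge => r hr.
rewrite lerBlDr -lerBlDl; apply: path_dist_ge => s hs.
by rewrite lerBlDl; apply: path_dist_le; exact: edge_path_cat hr hs.
Qed.

HB.instance Definition _ := isMetric.Build R X
  path_distxx path_dist_positivity path_dist_sym path_dist_triangle.

Definition is_vertex (x : X) := exists v, x = vpoint v.

Definition is_midpoint (x : X) :=
  exists u v, [/\ adj u v, x u = 2^-1 & x v = 2^-1].

End Realization.

Record isom (R : realType) (T : simplicial_tree) := Isom {
  isom_fun :> realization R T -> realization R T;
  isom_inv : realization R T -> realization R T;
  isom_funK : cancel isom_fun isom_inv;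
  isom_invK : cancel isom_inv isom_fun;
  isom_dist : forall x y, mdist (isom_fun x) (isom_fun y) = mdist x y;
  isom_vertex : forall x, is_vertex (isom_fun x) <-> is_vertex x
}.

Section IsomGroup.
Context {R : realType} {T : simplicial_tree}.
Implicit Types f g h : isom R T.

Lemma isom_eq f g : f =1 g -> f = g.
Proof.
case: f g => [f f' fK f'K f1 f2] [g g' gK g'K g1 g2] /= /funext fg; subst g.
have f'g' : f' = g' by apply/funext => x; rewrite -[x in LHS]g'K fK.
by subst g'; congr Isom; exact: Prop_irrelevance.
Qed.

HB.instance Definition _ := gen_eqMixin (isom R T).
HB.instance Definition _ := gen_choiceMixin (isom R T).

Definition isom_id : isom R T :=
  @Isom R T id id (fun=> erefl) (fun=> erefl) (fun _ _ => erefl)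
    (fun x => iff_refl _).

Lemma isom_inv_dist f x y : mdist (isom_inv f x) (isom_inv f y) = mdist x y.
Proof. by rewrite -(isom_dist f) !isom_invK. Qed.

Lemma isom_inv_vertex f x : is_vertex (isom_inv f x) <-> is_vertex x.
Proof. by rewrite -(isom_vertex f) isom_invK. Qed.

Definition isom_V f : isom R T :=
  Isom (@isom_invK _ _ f) (@isom_funK _ _ f) (isom_inv_dist f)
    (isom_inv_vertex f).

Lemma isom_comp_dist f g x y : mdist ((f \o g) x) ((f \o g) y) = mdist x y.
Proof. by rewrite /= !isom_dist. Qed.

Lemma isom_comp_vertex f g x : is_vertex ((f \o g) x) <-> is_vertex x.
Proof. by rewrite /= !isom_vertex. Qed.

Definition isom_comp f g : isom R T :=
  Isom (can_comp (@isom_funK _ _ f) (@isom_funK _ _ g))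
    (can_comp (@isom_invK _ _ g) (@isom_invK _ _ f)) (isom_comp_dist f g)
    (isom_comp_vertex f g).

Lemma isom_compA : associative isom_comp.
Proof. by move=> f g h; exact: isom_eq. Qed.

Lemma isom_comp1f : left_id isom_id isom_comp.
Proof. by move=> f; exact: isom_eq. Qed.

Lemma isom_compf1 : right_id isom_id isom_comp.
Proof. by move=> f; exact: isom_eq. Qed.

Lemma isom_compVf : left_inverse isom_id isom_V isom_comp.
Proof. by move=> f; apply: isom_eq => x /=; rewrite isom_funK. Qed.

Lemma isom_compfV : right_inverse isom_id isom_V isom_comp.
Proof. by move=> f; apply: isom_eq => x /=; rewrite isom_invK. Qed.

HB.instance Definition _ := isGroup.Build (isom R T)
  isom_compA isom_comp1f isom_compf1 isom_compVf isom_compfV.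

HB.instance Definition _ := Topological.copy (isom R T)
  (initial_topology (fun f => (f : realization R T -> realization R T)
     : {ptws realization R T -> realization R T})).

End IsomGroup.

Section Groups.
Context {gT : groupType}.
Local Open Scope group_scope.

Definition generated (S : set gT) : set gT :=
  smallest (fun H : set gT => group_closed (mem H)) S.

(* Words in two letters and their inverses: [(i, e)] is the letter number [i],
   inverted when [e] is true. *)
Definition letter_val (x y : gT) (a : bool * bool) : gT :=
  let g := if a.1 then y else x in if a.2 then g^-1 else g.

Definition word_val (x y : gT) (w : seq (bool * bool)) : gT :=
  \prod_(a <- w) letter_val x y a.

Definition reduced (w : seq (bool * bool)) :=
  sorted (fun a b : bool * bool => ~~ ((a.1 == b.1) && (a.2 != b.2))) w.

(* To be applied to a subgroup [G]. *)
Definition free_of_rank_two (G : set gT) :=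
  exists x y, [/\ G x, G y &
    forall g, G g -> exists! w, reduced w /\ word_val x y w = g].

End Groups.

Definition is_discrete {S : topologicalType} (G : set S) :=
  forall U : set (set_type G), open U.

Section TranslationLength.
Context (R : realType) (T : simplicial_tree).

Definition is_inversion (g : isom R T) :=
  exists u v : T, [/\ adj u v, g (vpoint u) = vpoint v &
                      g (vpoint v) = vpoint u].

Definition without_inversions := forall g : isom R T, ~ is_inversion g.

(* The tree T* has the same underlying space as T. When T is subdivided, the
   midpoints of the edges become vertices, and since the half-edges are given
   length one all the distances are doubled. *)
Definition tstar_vertex (x : realization R T) :=
  is_vertex x \/ (~ without_inversions /\ is_midpoint x).

Definition tstar_dist (x y : realization R T) : R :=
  if `[< without_inversions >] then mdist x y else 2 * mdist x y.

(* The infimum is a minimum: distances between vertices of T* are integers. *)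
Definition translation_length (g : isom R T) : R :=
  inf [set tstar_dist x (g x) | x in tstar_vertex].

End TranslationLength.

Section Procedure.
Context {R : realType} {gT : groupType} (l : gT -> R).
Local Open Scope group_scope.

Inductive state :=
| Step1 of gT & gT
| Step2 of gT & gT
| Step3 of gT & gT
| Step4 of gT & gT & R
| Step5 of gT & gT & R
| Step6 of gT & gT
| ReturnFalse
| ReturnTrue of gT & gT.

Inductive next : state -> state -> Prop :=
| next1_false X Y : l X = 0%R \/ l Y = 0%R -> next (Step1 X Y) ReturnFalse
| next1 X Y : ~ (l X = 0%R \/ l Y = 0%R) -> next (Step1 X Y) (Step2 X Y)
| next2_swap X Y : (l X > l Y)%R -> next (Step2 X Y) (Step3 Y X)
| next2 X Y : ~ (l X > l Y)%R -> next (Step2 X Y) (Step3 X Y)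
| next3 X Y :
    next (Step3 X Y) (Step4 X Y (Num.min (l (X * Y)) (l (X^-1 * Y))))
| next4_false X Y m : m = 0%R -> next (Step4 X Y m) ReturnFalse
| next4 X Y m : m <> 0%R -> next (Step4 X Y m) (Step5 X Y m)
| next5_replace X Y m Z : (m <= l Y - l X)%R ->
    Z = X * Y \/ Z = X^-1 * Y -> l Z = m -> next (Step5 X Y m) (Step2 X Z)
| next5 X Y m : ~ (m <= l Y - l X)%R -> next (Step5 X Y m) (Step6 X Y)
| next6 X Y : next (Step6 X Y) (ReturnTrue X Y).

(* The choice in step 5 makes the procedure nondeterministic: termination is
   the absence of an infinite run, and the outcomes are the final states of
   all the possible runs. *)
Definition terminates (s : state) :=
  forall run : nat -> state, run 0%N = s -> ~ forall n, next (run n) (run n.+1).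

Definition final_state (s t : state) :=
  clos_refl_trans state next s t /\ ~ exists t', next t t'.

End Procedure.

Section PingPong.
Context {R : realType} {T : simplicial_tree}.

Definition ping_pong (X Y : isom R T) :=
  exists Up Um Vp Vm : set (realization R T),
  [/\ [/\ Up !=set0, Um !=set0, Vp !=set0 & Vm !=set0],
      [/\ closed Up, closed Um, closed Vp & closed Vm],
      [/\ Up `&` Um = set0, Up `&` Vp = set0 & Up `&` Vm = set0] /\
      [/\ Um `&` Vp = set0, Um `&` Vm = set0 & Vp `&` Vm = set0],
      Up `|` Um `|` Vp `|` Vm <> setT &
      [/\ X @` (~` Um) `<=` Up, (X^-1)%g @` (~` Up) `<=` Um,
          Y @` (~` Vm) `<=` Vp & (Y^-1)%g @` (~` Vp) `<=` Vm]].

End PingPong.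

(* Main.v *)
(** The subdivided tree is not needed: an isometry other than an inversion
    attains its least displacement at a vertex of T, and distances to vertices
    satisfy the four-point condition.  If X and Y
    are hyperbolic with l(X) <= l(Y) and both l(XY) and l(X^-1 Y) exceed
    l(Y) - l(X), then the axes are disjoint or overlap in less than l(X).
    Stepping backwards along the axes from the start of the overlap, or from
    the ends of the bridge between disjoint axes, gives edges e of Ax(X) and f
    of Ax(Y) such that e, Xe, f, Yf bound four disjoint half-trees, which are
    ping-pong sets.  A closed ping-pong configuration forces discreteness and
    freeness.  Conversely a run returning false exhibits a generating pair one
    of whose members or products is elliptic; in a discrete free group elliptic
    elements have finite order, hence are trivial, and the group would be
    abelian. *)

Require Import Defs.
From mathcomp Require Import all_boot all_order all_algebra.
From mathcomp Require Import all_classical all_reals all_analysis.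
From mathcomp Require Import zify ring lra.

Set Implicit Arguments.
Unset Strict Implicit.
Unset Printing Implicit Defensive.

Import Order.TTheory GRing.Theory Num.Theory.

(** * The combinatorial metric *)

Section TreeDist.
Variable T : simplicial_tree.
Implicit Types u v w x y z : T.

Lemma walk_ex u v :
  exists n, `[< exists2 p, path (@adj T) u p & last u p = v /\ size p = n >].
Proof.
by have [p pp lp] := tree_connected u v; exists (size p); apply/asboolP; exists p.
Qed.

Definition dist u v := ex_minn (walk_ex u v).

Lemma dist_path u v :
  exists2 p, path (@adj T) u p & last u p = v /\ size p = dist u v.
Proof. by rewrite /dist; case: ex_minnP => n /asboolP. Qed.

Lemma dist_le u p : path (@adj T) u p -> dist u (last u p) <= size p.
Proof.
move=> pp; rewrite /dist; case: ex_minnP => n _; apply.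
by apply/asboolP; exists p.
Qed.

Lemma distxx u : dist u u = 0.
Proof. by have := @dist_le u [::] isT; rewrite leqn0 => /eqP. Qed.

Lemma dist_eq0 u v : dist u v = 0 -> u = v.
Proof.
by have [p _ [<- <-]] := dist_path u v => /size0nil ->.
Qed.

Lemma dist_triangle v u w : dist u w <= dist u v + dist v w.
Proof.
have [p pp [pv <-]] := dist_path u v; have [q qq [qw <-]] := dist_path v w.
rewrite -size_cat -qw -pv -last_cat dist_le// cat_path pp.
by rewrite pv.
Qed.

Lemma dist_sym u v : dist u v = dist v u.
Proof.
suff H x y : dist x y <= dist y x by apply/eqP; rewrite eqn_leq !H.
have [p pp [<- <-]] := dist_path y x.
have := @dist_le (last y p) (rev (belast y p)).
rewrite rev_path size_rev size_belast => H.
have yE : last (last y p) (rev (belast y p)) = y.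
  by case: (p) => //= a l; rewrite rev_cons last_rcons.
rewrite yE in H; apply: H; move: pp; apply: sub_path => a b.
by rewrite adj_sym.
Qed.

Lemma dist_adj u v : (dist u v == 1) = adj u v.
Proof.
apply/idP/idP => [/eqP d1|uv].
  have [p + []] := dist_path u v; rewrite d1 => + <-.
  by case: p => [//|a [|]//=]; rewrite andbT.
have := @dist_le u [:: v]; rewrite /= uv => /(_ isT).
case E: (dist u v) => [|[|//]] // _.
by move: uv; rewrite (dist_eq0 E) adj_irr.
Qed.

Lemma dist_adj1 u v : adj u v -> dist u v = 1.
Proof. by rewrite -dist_adj => /eqP. Qed.

Lemma dist_between u v k : k <= dist u v ->
  exists2 w, dist u w = k & dist w v = dist u v - k.
Proof.
have [p pp [pv sp]] := dist_path u v => kp.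
have pE : p = take k p ++ drop k p by rewrite cat_take_drop.
move: pp; rewrite pE cat_path => /andP[p1 p2].
exists (last u (take k p)); have := dist_le p1; have := dist_le p2.
all: rewrite -last_cat -pE pv size_drop size_takel sp //.
all: have := dist_triangle (last u (take k p)) u v; lia.
Qed.

(* Two such neighbours would be joined by a path avoiding [v], which closes up
   to a cycle through [v]. *)
Lemma nearer_unique w v u1 u2 : adj v u1 -> adj v u2 ->
  dist u1 w <= dist v w -> dist u2 w <= dist v w -> u1 = u2.
Proof.
move=> vu1 vu2 d1 d2.
(* [e] is adjacency in the tree with [v] deleted. A path from [u] through [v] to [w] is longer than
   [dist v w], so a geodesic from [u] to [w] survives the deletion. *)
pose e : rel T := [rel a b | [&& adj a b, a != v & b != v]].
have avoid u : adj v u -> dist u w <= dist v w ->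
    exists2 p, path e u p & last u p = w.
  move=> vu duw; have [p pp [pw sp]] := dist_path u w; exists p => //.
  have vp : v \notin u :: p.
    apply/negP; rewrite inE => /orP[/eqP vu'|].
      by move: vu; rewrite vu' adj_irr.
    move=> /splitPr vp; case: vp pp pw sp => p1 p2.
    rewrite cat_path /= last_cat /= => /and3P[pp1 h pp2] pw.
    have := dist_le pp2; rewrite pw size_cat /=.
    have := dist_adj1 vu; have := distxx v; lia.
  elim: (p) u vp pp {pw sp vu duw} => //= a l IH u.
  rewrite !inE !negb_or => /and3P[vu va vl] /andP[ua al].
  by rewrite {1}/e /= ua eq_sym vu eq_sym va /= IH// inE negb_or va.
have e_sym : symmetric e.
  by move=> a b; rewrite /e /= adj_sym; congr andb; rewrite andbC.
have [p1 pp1 lp1] := avoid _ vu1 d1.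
have [p2 pp2 lp2] := avoid _ vu2 d2.
have [p pp lp] : exists2 p, path e u1 p & last u1 p = u2.
  exists (p1 ++ rev (belast u2 p2)); rewrite ?cat_path ?last_cat ?pp1.
    rewrite /= lp1 -lp2 rev_path; move: pp2; apply: sub_path => a b.
    by rewrite e_sym.
  rewrite lp1 -lp2; case: (p2) => //= a l.
  by rewrite rev_cons last_rcons.
case/shortenP: pp lp => q qq uq _ lq.
apply/eqP; apply/negPn/negP => u12.
(* If [u1] and [u2] differ, the duplicate-free path from [u1] to [u2] closes up through [v] to a
   cycle of size at least 3. *)
have H := @tree_acyclic T (v :: u1 :: q).
have vq : v \notin u1 :: q.
  apply/negP => vq; have : all (fun b => b != v) (u1 :: q).
    rewrite /= (_ : u1 != v) /=; last first.
      by apply: contraTneq vu1 => ->; rewrite adj_irr.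
    by elim: (q) (u1) qq => //= a l IH b /andP[/and3P[_ _ ->]] /IH.
  by move=> /allP/(_ _ vq); rewrite eqxx.
have {}H : size (v :: u1 :: q) <= 2.
  apply: H; rewrite /ucycle cons_uniq vq uq !andbT.
  rewrite /cycle /= rcons_path vu1 lq adj_sym vu2 andbT /=.
  by move: qq; apply: sub_path => a b /and3P[].
by case: q lq H {qq uq vq} => //= lq _; rewrite lq eqxx in u12.
Qed.

(** If [u] and [v] were equidistant from [w], then [u] and the next vertex from [v] towards [w]
    would be two neighbours of [v] no farther from [w] than [v], hence equal, although their
    distances to [w] differ. *)
Lemma dist_step w v u : adj v u ->
  dist u w = (dist v w).+1 \/ dist v w = (dist u w).+1.
Proof.
move=> vu; have d1 := dist_adj1 vu.
have h1 := dist_triangle u v w; have h2 := dist_triangle v u w.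
rewrite (dist_sym u v) in h2.
case: (ltngtP (dist u w) (dist v w)) => h; [right; lia|left; lia|].
have [vw|vw] := eqVneq v w.
  by rewrite -vw distxx dist_sym d1 in h.
have vw1 : 1 <= dist v w.
  by rewrite lt0n; apply: contra vw => /eqP/dist_eq0 ->.
have [v' e1 e2] := dist_between vw1.
have vv' : adj v v' by rewrite -dist_adj e1.
have uv' : u = v' by apply: (@nearer_unique w v) => //; lia.
move: e2 h; rewrite -uv'; lia.
Qed.

(** A geodesic that starts by moving away from [y] cannot turn back: [x] is the only neighbour of
    [x'] nearer to [y], so the next vertex towards [w] is again farther from [y]. *)
Lemma between_of_step w y x x' : adj x x' -> dist x w = (dist x' w).+1 ->
  dist x' y = (dist x y).+1 -> dist y w = dist y x + dist x w.
Proof.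
move=> xx' dw dy; elim: {x' w}(dist x' w) {-2}w {-2}x' (erefl (dist x' w))
  x xx' dw dy => [|n IH] w x' dn x xx' dw dy.
  by rewrite dw dn addn1 -(dist_eq0 dn) (dist_sym y x) dist_sym.
have h1 : 1 <= dist x' w by rewrite dn.
have [x'' e1 e2] := dist_between h1.
have x'x'' : adj x' x'' by rewrite -dist_adj e1.
have [dy''|dy''] := dist_step y x'x''.
  have := IH w x'' _ x' x'x'' _ dy''.
  have := dist_sym x y; have := dist_sym x' y; lia.
have x'x : adj x' x by rewrite adj_sym.
have : x'' = x by apply: (@nearer_unique y x') => //; lia.
move=> xE; subst x; lia.
Qed.

(** A tree is 0-hyperbolic. Induction moves [x] one step towards [w]: either [y] and [z] come nearer
    too and the three sums drop together, or [x] lies between one of [y], [z], [w] and the other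
    two. *)
Lemma four_point x y z w :
  dist x y + dist z w <= dist x z + dist y w \/
  dist x y + dist z w <= dist x w + dist y z.
Proof.
suff : (dist x y + dist z w <= dist x z + dist y w \/
  dist x y + dist z w <= dist x w + dist y z) /\
  (dist x z + dist y w <= dist x y + dist z w \/
  dist x z + dist y w <= dist x w + dist y z) /\
  (dist x w + dist y z <= dist x y + dist z w \/
  dist x w + dist y z <= dist x z + dist y w) by case.
elim: {x}(dist x w) {-2}x (erefl (dist x w)) => [|n IH] x dn.
  rewrite dn (dist_eq0 dn) (dist_sym w y) (dist_sym w z).
  have := dist_triangle w y z; rewrite (dist_sym w z); lia.
have h1 : 1 <= dist x w by rewrite dn.
have [x' e1 e2] := dist_between h1.
have xx' : adj x x' by rewrite -dist_adj e1.
have dw : dist x w = (dist x' w).+1 by lia.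
have {}IH := IH x' _.
have yx := dist_sym y x; have zx := dist_sym z x; have zy := dist_sym z y.
have b := @between_of_step _ _ x x' xx'.
have tyz := dist_triangle x y z; have tyw := dist_triangle x y w.
have tzw := dist_triangle x z w.
case: (dist_step y xx') => dy; case: (dist_step z xx') => dz.
- have := b w y dw dy; have := b w z dw dz; lia.
- have := b z y dz dy; have := b w y dw dy; lia.
- have := b y z dy dz; have := b w z dw dz; lia.
- lia.
Qed.

End TreeDist.

(** * The metric of the realisation *)

Section RealizationDist.
Local Open Scope ring_scope.
Context {R : realType} {T : simplicial_tree}.
Local Notation X := (realization R T).
Local Notation vpt := (@vpoint R T).
Implicit Types (u v w : T) (x y : X).

Lemma mdistE x y : mdist x y = path_dist x y. Proof. by []. Qed.

Lemma adj_neq u v : adj u v -> u != v.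
Proof. by apply: contraTneq => ->; rewrite adj_irr. Qed.

Lemma carried_sum_adj u v x : adj u v -> carried u v x -> x u + x v = 1.
Proof.
by move=> /adj_neq uv /carried_sum; rewrite (negPf uv).
Qed.

Lemma carriedxx u x : carried u u x -> x = vpt u.
Proof.
move=> xu; have := carried_sum xu; rewrite eqxx addr0 => xu1.
apply: realization_eq => w /=; rewrite /vcoord; case: eqVneq => [->//|wu].
by apply/eqP; apply: contraNT wu => /xu[] ->.
Qed.

Lemma point_cases x :
  (exists u, x = vpt u) \/ exists u v, adj u v /\ carried u v x.
Proof.
have [u [v [/orP[/eqP<-|uv] c]]] := coord_carried x.
  by left; exists u; exact: carriedxx.
by right; exists u, v.
Qed.

(** The distance to [w] extended affinely over edges. Being 1-Lipschitz along edge paths, it bounds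
    their lengths from below; [mdist_vpointE] identifies it with the metric. *)
Definition affine_dist w x : R := \sum_(v \in setT) x v * (dist v w)%:R.

Lemma affine_dist_adj w u v x : adj u v -> carried u v x ->
  affine_dist w x = x u * (dist u w)%:R + x v * (dist v w)%:R.
Proof.
move=> uv c; rewrite /affine_dist (fsbigE [:: u; v]) /=.
- by rewrite !big_cons big_nil !in_setT addr0.
- by rewrite inE andbT adj_neq.
- by [].
- move=> a _; rewrite !inE => auv; have [->|/c[av|av]] := eqVneq (x a) 0.
  + by rewrite mul0r.
  + by rewrite av eqxx in auv.
  + by rewrite av eqxx orbT in auv.
Qed.

Lemma affine_dist_vpoint w u : affine_dist w (vpt u) = (dist u w)%:R.
Proof.
rewrite /affine_dist -(fsbig_widen [set u]%classic)//=.
  by rewrite fsbig_set1 /vcoord eqxx mul1r.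
by move=> v [_ vu] /=; rewrite /vcoord; case: eqP => // _; rewrite mul0r.
Qed.

Lemma affine_dist_lipschitz w x y r :
  edge_path x y r -> `|affine_dist w x - affine_dist w y| <= r.
Proof.
elim=> {x y r} [x|u v x y z r suv xu yu _ IH]; first by rewrite subrr normr0.
rewrite -(subrKA (affine_dist w y)) (le_trans (ler_normD _ _))// lerD//.
case/orP: suv => [/eqP uv|uv].
  by subst v; rewrite (carriedxx xu) (carriedxx yu) !subrr.
rewrite !(@affine_dist_adj _ u v)//.
have xs := carried_sum_adj uv xu; have ys := carried_sum_adj uv yu.
have -> : x v = 1 - x u by lra.
have -> : y v = 1 - y u by lra.
rewrite (_ : _ - _ = (x u - y u) * ((dist u w)%:R - (dist v w)%:R));
  last by ring.
rewrite normrM ler_piMr//.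
case: (dist_step w uv) => ->; rewrite -natr1 ?opprD ?addrA.
  by rewrite subrr add0r normrN normr1.
by rewrite [_ + 1]addrC -addrA subrr addr0 normr1.
Qed.

Lemma edge_path_vpoint u v : edge_path (vpt u) (vpt v) (dist u v)%:R.
Proof.
have [p pp [<- <-]] := dist_path u v.
elim: p u {v} pp => [|a p IH] u /=; first by move=> _; exact: edge_path_nil.
move=> /andP[ua /IH h]; rewrite -natr1 addrC.
have e1 : `|vpt u u - vpt a u| = 1.
  by rewrite /= /vcoord eqxx (negPf (adj_neq ua)) subr0 normr1.
rewrite -[X in X + _]e1; apply: (@edge_path_cons _ _ u a) h.
    by rewrite /is_simplex ua orbT.
  exact: vpoint_carriedl.
exact: vpoint_carriedr.
Qed.

Lemma mdist_vpointE x w : mdist x (vpt w) = affine_dist w x.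
Proof.
rewrite mdistE; apply/eqP; rewrite eq_le; apply/andP; split; last first.
  apply: path_dist_ge => r /(affine_dist_lipschitz w).
  rewrite affine_dist_vpoint distxx subr0; apply: le_trans.
  exact: ler_norm.
case: (point_cases x) => [[u ->]|[u0 [v0 [uv0 c0]]]].
  by rewrite affine_dist_vpoint path_dist_le//; exact: edge_path_vpoint.
(* The edge is oriented so that [u] is its end nearer to [w]; the path through [u] attains the lower
   bound. *)
have [u [v [uv c duv]]] : exists u v,
    [/\ adj u v, carried u v x & dist v w = (dist u w).+1].
  case: (dist_step w uv0) => h; last first.
    exists v0, u0; split=> //; first by rewrite adj_sym.
    by move=> a /c0; tauto.
  by exists u0, v0.
have su : is_simplex u v by rewrite /is_simplex uv orbT.
have h := edge_path1 su c (@vpoint_carriedl R _ u v).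
apply: le_trans (path_dist_le (edge_path_cat h (edge_path_vpoint u w))) _.
rewrite (affine_dist_adj _ uv c) duv -natr1 /= /vcoord eqxx.
have xs := carried_sum_adj uv c; have := coord_ge0 x v.
have -> : `|x u - 1| = x v.
  by rewrite distrC ger0_norm; have := coord_ge0 x v; lra.
have -> : x u = 1 - x v by lra.
lra.
Qed.

Lemma mdist_adj w u v x : adj u v -> carried u v x ->
  mdist x (vpt w) = x u * (dist u w)%:R + x v * (dist v w)%:R.
Proof. by rewrite mdist_vpointE; exact: affine_dist_adj. Qed.

Lemma mdist_vpoint u v : mdist (vpt u) (vpt v) = (dist u v)%:R.
Proof. by rewrite mdist_vpointE affine_dist_vpoint. Qed.

Lemma four_point_realization x a b c :
  mdist x (vpt a) + (dist b c)%:R <= mdist x (vpt b) + (dist a c)%:R \/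
  mdist x (vpt a) + (dist b c)%:R <= mdist x (vpt c) + (dist a b)%:R.
Proof.
case: (point_cases x) => [[u ->]|[u [v [uv cx]]]].
  by rewrite !mdist_vpoint -!natrD !ler_nat; exact: four_point.
rewrite !(mdist_adj _ uv cx).
have xs := carried_sum_adj uv cx.
have xu := coord_ge0 x u; have xv := coord_ge0 x v.
have -> : x u = 1 - x v by lra.
have {xs xu} xu : x v <= 1 by lra.
have h1 := four_point u a b c; have h2 := four_point v a b c.
have step w : (dist v w)%:R = (dist u w)%:R + 1 :> R /\
    dist v w = (dist u w).+1 \/
    (dist v w)%:R = (dist u w)%:R - 1 :> R /\ dist u w = (dist v w).+1.
  case: (dist_step w uv) => ->; [left|right]; rewrite -natr1; split=> //.
  by rewrite addrK.
have N (m n p q : nat) : (m + n <= p + q)%N ->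
    m%:R + n%:R <= p%:R + q%:R :> R by rewrite -!natrD ler_nat.
(* One and the same alternative holds at both ends of the edge, so it passes to the convex
   combination. *)
have {h1 h2} : ((dist u a + dist b c <= dist u b + dist a c)%N /\
    (dist v a + dist b c <= dist v b + dist a c)%N) \/
    ((dist u a + dist b c <= dist u c + dist a b)%N /\
    (dist v a + dist b c <= dist v c + dist a b)%N).
  case: (step a) => -[_ ea]; case: (step b) => -[_ eb];
    case: (step c) => -[_ ec]; lia.
case=> -[/N h1 /N h2]; [left|right]; nra.
Qed.

(** The distances from [y] to [u] and [v] add up to 1. At a vertex other than [u] and [v] this sum
    is at least 2, so by affinity [y] lies on the edge, where one coordinate determines it. *)
Lemma point_rigid u v x y : adj u v -> carried u v x ->
  mdist y (vpt u) = mdist x (vpt u) ->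
  mdist y (vpt v) = mdist x (vpt v) -> y = x.
Proof.
move=> uv cx yu yv.
suff cy : carried u v y.
  have xs := carried_sum_adj uv cx; have ys := carried_sum_adj uv cy.
  have e : y u = x u.
    move: yv; rewrite !(mdist_adj _ uv)// distxx !mulr0 !addr0.
    by rewrite dist_adj1// !mulr1.
  apply: realization_eq => w.
  have [->//|wu] := eqVneq w u; have [->|wv] := eqVneq w v; first lra.
  have z0 (z : X) : carried u v z -> z w = 0.
    move=> cz; apply/eqP; apply: contraNT wu => /cz[->//|wv'].
    by rewrite wv' eqxx in wv.
  by rewrite (z0 _ cx) (z0 _ cy).
have s1 : mdist y (vpt u) + mdist y (vpt v) = 1.
  rewrite yu yv !(mdist_adj _ uv cx) !distxx (dist_adj1 uv) dist_sym dist_adj1//.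
  by have := carried_sum_adj uv cx; lra.
have N a : (1 <= dist a u + dist a v)%N /\
    ((dist a u + dist a v)%N = 1%N -> a = u \/ a = v).
  have := dist_triangle a u v; rewrite (dist_adj1 uv) (dist_sym u a).
  split=> // h; case E: (dist a u) => [|k]; first by left; exact: dist_eq0.
  by right; apply: dist_eq0; lia.
case: (point_cases y) => [[a ya]|[a [b [ab cy]]]].
  move: s1; rewrite ya !mdist_vpoint -natrD => /eqP.
  by rewrite (eqr_nat _ _ 1) => /eqP/(N a).2 h w /vcoord_supp ->.
move: s1; rewrite !(mdist_adj _ ab cy) => s1 w w0.
have ys := carried_sum_adj ab cy.
have ya := coord_ge0 y a; have yb := coord_ge0 y b.
have [Na Na'] := N a; have [Nb Nb'] := N b.
have NR (n : nat) : (1 <= n)%N -> n = 1%N \/ 2 <= n%:R :> R.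
  by case: n => [//|[|n]] _; [left|right; rewrite (ler_nat _ 2)].
have NR1 (n : nat) : (1 <= n)%N -> 1 <= n%:R :> R.
  by rewrite (ler_nat _ 1).
have : y a * (dist a u + dist a v)%:R + y b * (dist b u + dist b v)%:R = 1.
  by move: s1; rewrite !natrD; nra.
have {}w0 : 0 < y w by rewrite lt_def w0 coord_ge0.
have /cy[wE|wE] : y w != 0 by rewrite gt_eqF.
  subst w; move=> h; case: (NR _ Na) => [/Na'//|h2].
  exfalso; have := ler_wpM2l ya h2; have := ler_wpM2l yb (NR1 _ Nb); lra.
subst w; move=> h; case: (NR _ Nb) => [/Nb'//|h2].
exfalso; have := ler_wpM2l yb h2; have := ler_wpM2l ya (NR1 _ Na); lra.
Qed.

End RealizationDist.

(** * Translations and facing edges *)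

Section Translations.
Variable T : simplicial_tree.
Implicit Types (a b c d e o s t u v w x y z : T) (f g h k : T -> T) (L M : nat).

Record isometry_pair (f g : T -> T) : Prop := IsometryPair {
  isometry_K : cancel f g;
  isometry_VK : cancel g f;
  isometry_dist : forall u v, dist (f u) (f v) = dist u v
}.

Lemma isometry_sym f g : isometry_pair f g -> isometry_pair g f.
Proof.
by case=> fK gK fd; split=> // u v; rewrite -fd !gK.
Qed.

(** The vertices displaced by exactly [L] form the axis. The last field says that orbits on the axis
    run straight, which excludes inversions. *)
Record translation (f g : T -> T) L : Prop := Translation {
  translation_iso : isometry_pair f g;
  translation_gt0 : 0 < L;
  translation_min : forall v, L <= dist v (f v);
  translation_axis : exists v, dist v (f v) = L;
  translation_square : forall v, dist v (f v) = L -> dist v (f (f v)) = L + L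
}.

Lemma translationV f g L : translation f g L -> translation g f L.
Proof.
case=> fg L0 fmin [v0 v0L] fsq.
have gE v : dist v (g v) = dist (g v) (f (g v)).
  by rewrite (isometry_VK fg) dist_sym.
split=> //.
- exact: isometry_sym.
- by move=> v; rewrite gE.
- by exists (f v0); rewrite gE (isometry_K fg).
- move=> v vL; have vL' : dist (g (g v)) (f (g (g v))) = L.
    by rewrite (isometry_VK fg) dist_sym (isometry_dist (isometry_sym fg)).
  by rewrite dist_sym; have := fsq _ vL'; rewrite !(isometry_VK fg).
Qed.

(** If the path from [v] over [f v] to [f (f v)] backtracked at [f v], the second vertex [q] of the
    first half would be displaced by less than [L], unless [L = 1] and [f] swaps [v] and [f v]. *)
Lemma displacement_square f g L : isometry_pair f g -> 0 < L ->
  (forall v, L <= dist v (f v)) ->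
  (forall v, adj v (f v) -> f (f v) <> v) ->
  forall v, dist v (f v) = L -> dist v (f (f v)) = L + L.
Proof.
move=> fg L0 fmin ninv v vL; have fd := isometry_dist fg.
have [|q q1 q2] := @dist_between _ v (f v) 1; first by rewrite vL.
have fvq : adj (f v) (f q) by rewrite -dist_adj fd q1.
have fq : dist (f q) (f (f v)) = L.-1 by rewrite fd q2 vL subn1.
have ffv : dist (f v) (f (f v)) = L by rewrite fd.
case: (dist_step v fvq) => h.
  have := @between_of_step _ (f (f v)) v (f v) (f q) fvq; rewrite vL ffv fq.
  by apply; lia.
have fp := four_point v (f v) q (f q); have qL := fmin q.
have s1 := dist_sym v (f q); have s2 := dist_sym v (f v).
have s3 := dist_sym (f v) q; have s4 := dist_adj1 fvq.
have L1 : L = 1 by lia.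
have q0 : q = f v by apply: dist_eq0; lia.
have fq0 : f q = v by apply: dist_eq0; lia.
by case: (ninv v); rewrite -?q0 // -dist_adj q1.
Qed.

Lemma four_chain a b c e : dist a c = dist a b + dist b c ->
  dist b e = dist b c + dist c e -> 0 < dist b c ->
  dist a e = dist a b + dist b c + dist c e.
Proof.
move=> ac be bc; have := four_point a c b e.
have := dist_sym c b; have := dist_triangle c a e; lia.
Qed.

(** A tree is bipartite. The parity later sharpens a strict inequality between distances by one. *)
Lemma dist_parity a b c :
  odd (dist a c) = odd (dist a b) (+) odd (dist b c).
Proof.
have [p pp [<- _]] := dist_path b c.
elim: p b {c} pp => [|x p IH] b /=; first by rewrite distxx addbF.
move=> /andP[bx /IH]; move: (last x p) => c ->.
have := dist_step a bx; have := dist_step c bx.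
rewrite (dist_sym x a) (dist_sym b a); lia.
Qed.

(** * Moving along an axis *)

Section Axis.
Variables (f g : T -> T) (L : nat).
Hypothesis fL : translation f g L.
Let fg := translation_iso fL.

Lemma axis_between v z : dist v (f v) = L ->
  dist v (f v) = dist v z + dist z (f v) -> dist z (f z) = L.
Proof.
move=> vL vz; have := translation_min fL z.
have := dist_triangle (f v) z (f z); rewrite (isometry_dist fg); lia.
Qed.

(** The vertex after [v] on the axis; applied to the inverse, this gives the vertex before [v]. *)
Lemma axis_next v : dist v (f v) = L -> exists z,
  [/\ adj v z, dist z (f z) = L, dist z (f v) = L.-1, dist (f z) v = L.+1
    & dist (g z) v = L.-1].
Proof.
move=> vL; have L0 := translation_gt0 fL.
have [|z z1 z2] := @dist_between _ v (f v) 1; first by rewrite vL.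
have zL : dist z (f z) = L by apply: (axis_between vL); lia.
exists z; split=> //; first by rewrite -dist_adj z1.
- by rewrite z2 vL subn1.
- have := translation_square fL vL.
  have := dist_triangle (f z) v (f (f v)); have := dist_triangle (f v) v (f z).
  rewrite !(isometry_dist fg) (dist_sym (f z)); lia.
- by rewrite -(isometry_dist fg) (isometry_VK fg) z2 vL subn1.
Qed.

End Axis.

Lemma axisV f g L v : translation f g L -> dist v (f v) = L -> dist v (g v) = L.
Proof.
case=> fg _ _ _ _ <-.
by rewrite -(isometry_dist fg) (isometry_VK fg) dist_sym.
Qed.

(** The last hypothesis makes the segments from [s] to [f s] and from [t] to [h t] part before their
    last edges, so the geodesic from [f s] to [h t] traverses both of these edges. *)
Lemma shorten_ends f g h k L M s t a c : translation f g L ->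
  translation h k M -> dist s (f s) = L -> dist t (h t) = M -> L <= M ->
  dist a s = 1 -> dist (f a) s = L.-1 ->
  dist c t = 1 -> dist (h c) t = M.-1 ->
  M + dist s t + 2 <= dist (f s) (h t) + L ->
  dist (f s) (h t) = (dist (f a) (h c)).+2.
Proof.
move=> fL hM sL tM LM as1 fas ct1 hct K2.
have L0 := translation_gt0 fL; have M0 := translation_gt0 hM.
have fsa : dist (f a) (f s) = 1 by rewrite (isometry_dist (translation_iso fL)).
have htc : dist (h c) (h t) = 1 by rewrite (isometry_dist (translation_iso hM)).
have p1 := four_point (f a) (h t) s (f s).
have p2 := four_point (h c) (f a) t (h t).
have t1 := dist_triangle t s (h t).
have t2 := dist_triangle s (f a) t.
have t3 := dist_triangle (f a) (f s) (h t).
have t4 := dist_triangle (h c) (f a) (h t).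
have e1 := dist_sym (h t) s; have e2 := dist_sym (h t) (f s).
have e3 := dist_sym (f s) (f a); have e4 := dist_sym (h c) (f a).
lia.
Qed.

(* For edges [ab] and [cd]: a geodesic visits [a], [b], [d], [c] in this order. *)
Definition facing a b c d := dist a c = (dist b d).+2.

Lemma facing_sym a b c d : facing a b c d -> facing c d a b.
Proof. by rewrite /facing (dist_sym c) (dist_sym d). Qed.

(** There is one facing condition for each pair among the half-trees cut off by [ab] on the side of
    [a], by [cd] on the side of [c], and by the image edges on the sides of [f b] and [h d]. *)
Definition schottky_edges (f h : T -> T) a b c d :=
  [/\ adj a b /\ adj c d, facing a b (f b) (f a), facing c d (h d) (h c),
      facing a b c d
    & [/\ facing a b (h d) (h c), facing (f b) (f a) c d
        & facing (f b) (f a) (h d) (h c)]].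

(** Inverting [h] exchanges its two half-trees, so the edge [cd] and its image trade roles. *)
Lemma schottky_edgesV f h k a b c d : isometry_pair h k ->
  schottky_edges f k a b c d -> schottky_edges f h a b (k d) (k c).
Proof.
move=> hk [[ab cd] e1 e2 e3 [e4 e5 e6]]; split; rewrite ?(isometry_VK hk)//.
  split=> //; rewrite -dist_adj (isometry_dist (isometry_sym hk)) dist_sym.
  by rewrite dist_adj.
exact: facing_sym.
Qed.

(* The facing edges lead from [s] and [t] backwards along the axes. *)
Lemma schottky_edges_base f g h k L M s t : translation f g L ->
  translation h k M -> L <= M -> dist s (f s) = L -> dist t (h t) = M ->
  dist (g s) (k t) = L + dist s t + M -> dist (g s) (h t) = L + dist s t + M ->
  dist (f s) (k t) = L + dist s t + M ->
  M + dist s t + 2 <= dist (f s) (h t) + L ->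
  exists a b c d, schottky_edges f h a b c d.
Proof.
move=> fL hM LM sL tM P1 P2 P3 P4.
have gL := translationV fL; have kM := translationV hM.
have gsL := axisV fL sL; have ktM := axisV hM tM.
(* [a] and [c] are the predecessors of [s] and [t] on the axes; the edges sought are [as] and
   [ct]. *)
have [a [sa aL a1 a2 a3]] := axis_next gL gsL.
have [c [tc cM c1 c2 c3]] := axis_next kM ktM.
have as1 : dist a s = 1 by rewrite dist_sym dist_adj1.
have ct1 : dist c t = 1 by rewrite dist_sym dist_adj1.
have L0 := translation_gt0 fL; have M0 := translation_gt0 hM.
have fd := isometry_dist (translation_iso fL).
have hd := isometry_dist (translation_iso hM).
have a3' := dist_sym s (f a); have c3' := dist_sym t (h c).
have fsa : dist (f a) (f s) = 1 by rewrite fd.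
have htc : dist (h c) (h t) = 1 by rewrite hd.
have sga := dist_sym (g s) a; have skc := dist_sym (k t) c.
have axsa : dist a (f s) = L.+1.
  have := translation_square gL gsL.
  have := dist_triangle a (g s) (f s); have := dist_triangle s a (f s).
  have := translation_square fL sL; have := fd (g s) s.
  rewrite (isometry_VK (translation_iso fL)).
  have := fd (g s) (f s); rewrite (isometry_VK (translation_iso fL)).
  lia.
have axtc : dist c (h t) = M.+1.
  have := translation_square kM ktM.
  have := dist_triangle c (k t) (h t); have := dist_triangle t c (h t).
  have := translation_square hM tM; have := hd (k t) t.
  rewrite (isometry_VK (translation_iso hM)).
  have := hd (k t) (h t); rewrite (isometry_VK (translation_iso hM)).
  lia.
exists a, s, c, t; split; rewrite /facing.
- by rewrite -!dist_adj as1 ct1.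
- by rewrite axsa a3' a3; lia.
- by rewrite axtc c3' c3; lia.
- have := dist_triangle a (g s) (k t); have := dist_triangle c a (k t).
  have := dist_triangle s a c; have := dist_triangle t s c.
  rewrite (dist_sym t c); lia.
- split; last exact: (shorten_ends fL hM).
  + have := dist_triangle a (g s) (h t); have := dist_triangle s (g s) (h c).
    have := dist_triangle (h c) (g s) (h t).
    have := dist_triangle s a (h t); have := dist_triangle (h c) s (h t).
    have := dist_triangle t s (h c); rewrite (dist_sym (g s) s); lia.
  + have := dist_triangle c (f s) (k t); have := dist_triangle t (f s) (k t).
    have := dist_triangle (f a) (f s) t.
    have := dist_triangle t (f s) c.
    have := dist_triangle s (f a) t.
    rewrite (dist_sym (f s) (f a)) (dist_sym t c); lia.
Qed.

(** * Facing edges for disjoint and for intersecting axes *)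

Section Schottky.
Variables (f g h k : T -> T) (L M : nat).
Hypotheses (fL : translation f g L) (hM : translation h k M) (LM : L <= M).
Let gL := translationV fL.
Let kM := translationV hM.

Lemma schottky_disjoint s t : dist s (f s) = L -> dist t (h t) = M ->
  0 < dist s t ->
  (forall u v, dist u (f u) = L -> dist v (h v) = M -> dist s t <= dist u v) ->
  exists a b c d, schottky_edges f h a b c d.
Proof.
move=> sL tM D0 Dmin.
(* By minimality the first step along the axis does not approach [v], so the whole segment from [u]
   to [f' u] leads away from [v]. *)
have away f' g' L' u v : translation f' g' L' -> dist u (f' u) = L' ->
    (forall z, dist z (f' z) = L' -> dist u v <= dist z v) ->
    dist (f' u) v = L' + dist u v.
  move=> f'L uL umin; have [z [uz zL z1 _ _]] := axis_next f'L uL.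
  have zv := umin _ zL; case: (dist_step v uz) => h1; last by lia.
  have := @between_of_step _ (f' u) v u z uz.
  have := translation_gt0 f'L; rewrite (dist_sym v u) (dist_sym v (f' u)); lia.
have fst := away _ _ _ _ t fL sL (fun z zL => Dmin _ _ zL tM).
have gst : dist (g s) t = L + dist s t.
  apply: (away _ _ _ _ _ gL (axisV fL sL)) => z zL.
  by apply: Dmin => //; exact: axisV gL zL.
have Dmin' z : dist z (h z) = M -> dist t s <= dist z s.
  by move=> zM; rewrite dist_sym (dist_sym z); exact: Dmin.
have hts := away _ _ _ _ s hM tM Dmin'.
have kts : dist (k t) s = M + dist t s.
  apply: (away _ _ _ _ _ kM (axisV hM tM)) => z zM.
  by apply: Dmin' => //; exact: axisV kM zM.
have tsE := dist_sym t s.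
have chain p q : dist p t = L + dist s t -> dist q s = M + dist t s ->
    dist p s = L -> dist q t = M -> dist p q = L + dist s t + M.
  move=> pt qs ps qt; have := @four_chain p s t q.
  rewrite (dist_sym s q) (dist_sym t q); lia.
have fs := dist_sym (f s) s; have ht := dist_sym (h t) t.
have gs := dist_sym (g s) s; have kt := dist_sym (k t) t.
have gsL := axisV fL sL; have ktM := axisV hM tM.
apply: (schottky_edges_base fL hM LM sL tM).
- by apply: chain => //; lia.
- by apply: chain => //; lia.
- by apply: chain => //; lia.
- have := translation_gt0 fL; rewrite (chain (f s) (h t)); lia.
Qed.

(* Moving [o] backwards along the overlap of the axes, or reversing [h], would
   bring the images of [o] under [f] and [h] closer. *)
Lemma schottky_crossing o : dist o (f o) = L -> dist o (h o) = M ->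
  (forall v, M < L + dist (f v) (h v)) ->
  (forall z, dist z (f z) = L -> dist z (h z) = M ->
    dist (f o) (h o) <= dist (f z) (h z) /\
    dist (f o) (h o) <= dist (f z) (k z)) ->
  exists a b c d, schottky_edges f h a b c d.
Proof.
move=> oL oM far omin; have L0 := translation_gt0 fL.
have M0 := translation_gt0 hM; have oo := distxx o.
have goL := axisV fL oL; have koM := axisV hM oM.
(* [far] gives this with 1 in place of 2; parity gains the missing unit. *)
have K2 : M + 2 <= dist (f o) (h o) + L.
  have := far o; have := dist_parity (f o) o (h o).
  rewrite (dist_sym (f o) o) oL oM; lia.
have [b [ob bL b1 b2 b3]] := axis_next gL goL.
have [z [oz zL z1 z2 z3]] := axis_next fL oL.
have bL' := axisV gL bL; have fd := isometry_dist (translation_iso fL).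
have hd := isometry_dist (translation_iso hM).
have kd := isometry_dist (translation_iso kM).
have hok : dist (k o) (h o) = M + M.
  rewrite -hd (isometry_VK (translation_iso hM)).
  exact: translation_square hM _ _.
have gof : dist (g o) (f o) = L + L.
  rewrite -fd (isometry_VK (translation_iso fL)).
  exact: translation_square fL _ _.
have on_h u : dist o u = 1 -> dist u (h o) = M.-1 -> dist u (h u) = M.
  by move=> *; apply: (axis_between hM oM); lia.
have on_k u : dist o u = 1 -> dist u (k o) = M.-1 -> dist u (h u) = M.
  move=> ou uko; apply: (axisV kM); apply: (axis_between kM koM); lia.
have ob1 := dist_adj1 ob; have oz1 := dist_adj1 oz.
have sfo := dist_sym (f o) o; have sho := dist_sym (h o) o.
have sko := dist_sym (k o) o; have sgo := dist_sym (g o) o.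
apply: (schottky_edges_base fL hM LM oL oM); rewrite ?oo ?addn0//.
(* If [b], the predecessor of [o] on the axis of [f], also led towards [k o], the axes would overlap
   behind [o], and [f b] and [h b] would be closer than [f o] and [h o] by two. *)
- case: (dist_step (k o) ob) => h1.
    have := @between_of_step _ (g o) (k o) o b ob.
    have := dist_sym (g o) (k o); lia.
  have bM : dist b (h b) = M by apply: on_k; lia.
  have := (omin b bL' bM).1.
  have hb : dist (h b) o = M.-1.
    by rewrite -kd (isometry_K (translation_iso hM)); lia.
  have b3' : dist (f b) o = L.-1 by [].
  have := @shorten_ends _ _ _ _ _ _ o o b b fL hM oL oM LM.
  rewrite (dist_sym b o) oo; lia.
(* If [b] led towards [h o], the axes would run in opposite directions; [f o] and [h o] would be
   [L + M] apart, but [f b] and [k b] at most [L + M - 2]. *)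
- case: (dist_step (h o) ob) => h1.
    have := @between_of_step _ (g o) (h o) o b ob.
    have := dist_sym (g o) (h o); lia.
  have bM : dist b (h b) = M by apply: on_h; lia.
  have bfo : dist b (f o) = L.+1.
    have := dist_triangle b (g o) (f o); have := dist_triangle o b (f o).
    have := dist_sym b (g o); have := dist_sym o b; lia.
  have := @between_of_step _ (h o) (f o) o b ob.
  have := (omin b bL' bM).2; have := dist_triangle o (f b) (k b).
  have -> : dist o (k b) = M.-1.
    by rewrite -hd (isometry_VK (translation_iso hM)) dist_sym; lia.
  have := dist_sym b (f o); lia.
(* Again the axes would run in opposite directions: [f o] and [h o] would be [L + M] apart, but
   [f o] and [k o] at most [L + M - 2]. *)
- case: (dist_step (k o) oz) => h1.
    have := @between_of_step _ (f o) (k o) o z oz.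
    have := dist_sym (f o) (k o); lia.
  have zM : dist z (h z) = M by apply: on_k; lia.
  have zho : dist z (h o) = M.+1.
    have := dist_triangle z (k o) (h o); have := dist_triangle o z (h o).
    have := dist_sym z (k o); have := dist_sym o z; lia.
  have := @between_of_step _ (f o) (h o) o z oz.
  have := (omin o oL oM).2; have := dist_triangle z (f o) (k o).
  have := dist_sym z (f o); have := dist_sym (f o) (h o); lia.
Qed.

End Schottky.

Lemma ex_minimizer (I : Type) (P : I -> Prop) (F : I -> nat) :
  (exists i, P i) -> exists2 i, P i & forall j, P j -> F i <= F j.
Proof.
move=> [i0 Pi0].
have ex : exists n, `[< exists2 i, P i & F i = n >].
  by exists (F i0); apply/asboolP; exists i0.
case: (ex_minnP ex) => n /asboolP[i Pi <-] nmin; exists i => // j Pj.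
by apply: nmin; apply/asboolP; exists j.
Qed.

(** [dist (f v) (h v)] is the displacement of [v] under the inverse of [f] after [h], and
    [dist (f v) (k v)] that of [k v] under [f] after [h]. Thus the two hypotheses bound the
    displacements of both products from below. *)
Lemma schottky_edges_exist f g h k L M : translation f g L ->
  translation h k M -> L <= M ->
  (forall v, M < L + dist (f v) (h v)) ->
  (forall v, M < L + dist (f v) (k v)) ->
  exists a b c d, schottky_edges f h a b c d.
Proof.
move=> fL hM LM far1 far2.
pose P (st : T * T) := dist st.1 (f st.1) = L /\ dist st.2 (h st.2) = M.
have [|[s t] [/= sL tM] Dmin] := @ex_minimizer _ P (fun st => dist st.1 st.2).
  have [s sL] := translation_axis fL; have [t tM] := translation_axis hM.
  by exists (s, t).
have [D0|D0] := posnP (dist s t); last first.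
  apply: (schottky_disjoint fL hM LM sL tM D0) => u v uL vM.
  exact: (Dmin (u, v)).
(* The axes meet. The minimum is taken over their common vertices and both orientations of [h]; the
   Boolean selects [h] or its inverse [k]. *)
pose Q (ob : T * bool) := dist ob.1 (f ob.1) = L /\ dist ob.1 (h ob.1) = M.
pose F (ob : T * bool) := dist (f ob.1) (if ob.2 then k ob.1 else h ob.1).
have [|[ o b] [/= oL oM] Fmin] := @ex_minimizer _ Q F.
  by exists (s, false); split=> //=; rewrite (dist_eq0 D0).
case: b Fmin => Fmin; last first.
  apply: (schottky_crossing fL hM LM oL oM far1) => z zL zM.
  by split; [exact: (Fmin (z, false))|exact: (Fmin (z, true))].
have kM := translationV hM; have hk := translation_iso hM.
have [|a [b [c [d]]]] :=
  @schottky_crossing f g k h L M fL kM LM o oL (axisV hM oM) far2.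
- move=> z zL zM; have zM' := axisV kM zM.
  by split; [exact: (Fmin (z, true))|exact: (Fmin (z, false))].
by move=> /(schottky_edgesV hk) e; exists a, b, (k d), (k c).
Qed.

End Translations.

(** * Action on vertices and half-trees *)

Section VertexAction.
Local Open Scope classical_set_scope.
Local Open Scope ring_scope.
Context {R : realType} {T : simplicial_tree}.
Local Notation X := (realization R T).
Local Notation vpt := (@vpoint R T).
Implicit Types (f g : isom R T) (u v w : T) (x y : X).

Lemma vpoint_inj : injective vpt.
Proof.
move=> u v /(congr1 (fun x : X => x u)) /=; rewrite /vcoord eqxx.
by case: eqVneq => // _ /eqP; rewrite oner_eq0.
Qed.

Definition vmap f v : T :=
  sval (cid ((isom_vertex f (vpt v)).2 (ex_intro _ v erefl))).

Lemma isom_vpoint f v : f (vpt v) = vpt (vmap f v).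
Proof. by rewrite /vmap; case: cid. Qed.

Lemma dist_vmap f u v : dist (vmap f u) (vmap f v) = dist u v.
Proof.
apply/eqP; rewrite -(eqr_nat R) -!mdist_vpoint -!isom_vpoint.
by rewrite isom_dist.
Qed.

Lemma vmap_mul f g v : vmap (f * g)%g v = vmap f (vmap g v).
Proof. by apply: vpoint_inj; rewrite -!isom_vpoint. Qed.

Lemma vmap1 v : vmap 1%g v = v.
Proof. by apply: vpoint_inj; rewrite -isom_vpoint. Qed.

Lemma vmap_pair f : isometry_pair (vmap f) (vmap f^-1%g).
Proof.
by split; last exact: dist_vmap; move=> v;
  rewrite -vmap_mul ?mulVg ?mulgV vmap1.
Qed.

Lemma adj_vmap f u v : adj (vmap f u) (vmap f v) = adj u v.
Proof. by rewrite -!dist_adj dist_vmap. Qed.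

Lemma isom_fix_edge f u v x : adj u v -> carried u v x ->
  vmap f u = u -> vmap f v = v -> f x = x.
Proof.
move=> uv cx fu fv; apply: (point_rigid uv cx).
  by rewrite -{1}fu -isom_vpoint isom_dist.
by rewrite -{1}fv -isom_vpoint isom_dist.
Qed.

(** For adjacent [u] and [v], the closed half-tree on the side of [u], cut at the midpoint of the
    edge. *)
Definition halfspace u v : set X :=
  [set x | mdist x (vpt u) <= mdist x (vpt v)].

Lemma closed_halfspace u v : closed (halfspace u v).
Proof.
rewrite -[halfspace u v]setCK; apply: open_closedC; rewrite openE => x /=.
move=> /negP; rewrite -ltNge => xvu; apply/nbhs_ballP.
exists ((mdist x (vpt u) - mdist x (vpt v)) / 2) => /=; first lra.
move=> y; rewrite ballEmdist /= => xy; apply/negP; rewrite -ltNge.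
have := metric_triangle x y (vpt u); have := metric_triangle y x (vpt v).
rewrite (metric_sym y x); lra.
Qed.

Lemma facing_disjoint a b c d : adj a b -> adj c d -> facing a b c d ->
  halfspace a b `&` halfspace c d = set0.
Proof.
move=> ab cd abcd; have ab1 := dist_adj1 ab; have cd1 := dist_adj1 cd.
have bc : dist b c = (dist b d).+1.
  have := dist_triangle b a c; have := dist_triangle d b c.
  by rewrite (dist_sym d c) abcd; lia.
have da : dist d a = (dist b d).+1.
  have := dist_triangle d a c; have := dist_triangle b a d.
  by rewrite (dist_sym d c) (dist_sym d a) abcd; lia.
apply/seteqP; split=> // x [] /=; rewrite /halfspace /= => xab xcd.
have := four_point_realization x b a c; have := four_point_realization x d c a.
rewrite (dist_sym c a) (dist_sym b a) (dist_sym d c) abcd bc da ab1 cd1.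
have := ler0n R (dist b d); rewrite -!natr1; lra.
Qed.

Lemma facing_notin a b c d : adj a b -> adj c d -> facing a b c d ->
  ~ halfspace c d (vpt b).
Proof.
move=> ab cd abcd; have ab1 := dist_adj1 ab; have cd1 := dist_adj1 cd.
have bc : dist b c = (dist b d).+1.
  have := dist_triangle b a c; have := dist_triangle d b c.
  by rewrite (dist_sym d c) abcd; lia.
by rewrite /halfspace /= !mdist_vpoint ler_nat bc ltnn.
Qed.

Lemma halfspace_self a b : halfspace a b (vpt a).
Proof. by rewrite /halfspace /= !mdist_vpoint distxx ler0n. Qed.

Lemma halfspace_isom f a b x :
  ~ halfspace a b x -> halfspace (vmap f b) (vmap f a) (f x).
Proof.
rewrite /halfspace /= -!isom_vpoint !isom_dist => /negP.
by rewrite -ltNge => /ltW.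
Qed.

Lemma ping_pong_edges f g a b c d :
  schottky_edges (vmap f) (vmap g) a b c d -> ping_pong f g.
Proof.
case=> -[ab cd] e1 e2 e3 [e4 e5 e6].
have fba : adj (vmap f b) (vmap f a) by rewrite adj_vmap adj_sym.
have gdc : adj (vmap g d) (vmap g c) by rewrite adj_vmap adj_sym.
have fK h u : vmap h^-1%g (vmap h u) = u.
  exact: (isometry_K (vmap_pair h)).
exists (halfspace (vmap f b) (vmap f a)), (halfspace a b),
  (halfspace (vmap g d) (vmap g c)), (halfspace c d); split.
- by split; [exists (vpt (vmap f b))|exists (vpt a)|exists (vpt (vmap g d))|
    exists (vpt c)]; exact: halfspace_self.
- by split; exact: closed_halfspace.
- split; split; rewrite ?(setIC (halfspace (vmap g d) _));
    try exact: facing_disjoint.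
  by rewrite setIC; exact: facing_disjoint.
(* The vertex [b] lies in none of the four half-trees. *)
- move=> cover; have : setT (vpt b) by [].
  rewrite -cover => -[[[|]|]|]; try exact: (facing_notin ab).
  rewrite /halfspace /= !mdist_vpoint distxx dist_sym dist_adj1//.
  by rewrite ler_nat.
- split=> _ [x /= xU <-]; try exact: halfspace_isom.
    by rewrite -(fK f a) -(fK f b); exact: halfspace_isom.
  by rewrite -(fK g c) -(fK g d); exact: halfspace_isom.
Qed.

End VertexAction.

(** * Translation lengths *)

Section TranslationLengths.
Local Open Scope classical_set_scope.
Local Open Scope ring_scope.
Context {R : realType} {T : simplicial_tree}.
Local Notation X := (realization R T).
Local Notation vpt := (@vpoint R T).
Local Notation l := (@translation_length R T).
Implicit Types (f g : isom R T) (u v w : T) (x y : X).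

Lemma midpoint_carried u v x : adj u v -> x u = 2^-1 -> x v = 2^-1 ->
  carried u v x.
Proof.
move=> uv xu xv; have uv' := adj_neq uv.
have half0 : 2^-1 != 0 :> R by rewrite invr_eq0 pnatr_eq0.
have [a [b [_ cx]]] := coord_carried x => w /cx wab.
have := cx u; have := cx v; rewrite xu xv => /(_ half0) vab /(_ half0) uab.
by case: uab vab uv' wab => <- [] <-; rewrite ?eqxx//; tauto.
Qed.

Lemma midpoint_ex u v : adj u v -> exists x, x u = 2^-1 /\ x v = 2^-1.
Proof.
move=> uv; have uv' := adj_neq uv.
pose m w : R := if (w == u) || (w == v) then 2^-1 else 0.
have m0 w : 0 <= m w by rewrite /m; case: ifP => // _; rewrite invr_ge0 ler0n.
have mc : exists a b, is_simplex a b /\ carried a b m.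
  exists u, v; split; first by rewrite /is_simplex uv orbT.
  move=> w; rewrite /m; case: ifP => [/orP[/eqP|/eqP]|_]; [by left|by right|].
  by rewrite eqxx.
have ms : \sum_(w \in [set: T]) m w = 1.
  rewrite (fsbigE [:: u; v]) /=.
  - rewrite !big_cons big_nil !in_setT /m !eqxx orbT addr0 /=; lra.
  - by rewrite inE andbT.
  - by [].
  - by move=> w _; rewrite !inE /m => wuv; rewrite ifN.
by exists (Point m0 mc ms); rewrite /= /m !eqxx orbT.
Qed.

(** The factor by which distances in the subdivided tree exceed those in [T]. *)
Definition tstar_scale : nat := if `[< without_inversions R T >] then 1 else 2.

Lemma tstar_scale_gt0 : (0 < tstar_scale)%N.
Proof. by rewrite /tstar_scale; case: ifP. Qed.

Lemma tstar_distE x y : tstar_dist x y = tstar_scale%:R * mdist x y.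
Proof. by rewrite /tstar_dist /tstar_scale; case: ifP; rewrite ?mul1r. Qed.

Lemma translation_length_lb f : lbound
  [set tstar_dist x (f x) | x in tstar_vertex (R := R) (T := T)] 0.
Proof.
by move=> _ [x _ <-]; rewrite tstar_distE mulr_ge0// ?ler0n// mdist_ge0.
Qed.

Lemma translation_length_leP f x : tstar_vertex x ->
  l f <= tstar_dist x (f x).
Proof.
by move=> xV; apply: ge_inf; [exists 0; exact: translation_length_lb|exists x].
Qed.

Lemma translation_length_geP f (s : R) :
  (forall x, tstar_vertex x -> s <= tstar_dist x (f x)) -> s <= l f.
Proof.
move=> h; apply: lb_le_inf; last by move=> _ [x xV <-]; exact: h.
have [v] := tree_inhabited T.
by eexists; exists (vpt v) => //; left; exists v.
Qed.

Lemma translation_length_le f v :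
  l f <= (tstar_scale * dist v (vmap f v))%:R.
Proof.
rewrite natrM -mdist_vpoint -isom_vpoint -tstar_distE.
by apply: translation_length_leP; left; exists v.
Qed.

(** An inversion fixes the midpoint of its edge, and its very existence makes midpoints vertices of
    the subdivided tree. *)
Lemma translation_length_inversion f : is_inversion f -> l f = 0.
Proof.
move=> [u [v [uv fu fv]]]; apply/eqP; rewrite eq_le; apply/andP; split;
  last first.
  apply: translation_length_geP => x xV.
  by apply: translation_length_lb; exists x.
have [x [xu xv]] := midpoint_ex uv.
have cx := midpoint_carried uv xu xv.
have fx : f x = x.
  apply: (point_rigid uv cx).
    rewrite -{1}fv isom_dist !(mdist_adj _ uv cx) !distxx.
    by rewrite (dist_adj1 uv) dist_sym (dist_adj1 uv) xu xv; lra.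
  rewrite -{1}fu isom_dist !(mdist_adj _ uv cx) !distxx.
  by rewrite (dist_adj1 uv) dist_sym (dist_adj1 uv) xu xv; lra.
have -> : 0 = tstar_dist x (f x) by rewrite tstar_distE fx mdistxx mulr0.
apply: translation_length_leP; right; split; last by exists u, v.
by move=> /(_ f); apply; exists u, v.
Qed.

(* A midpoint moved less than every vertex lies on an edge which is swapped. *)
Lemma midpoint_displacement f n x : ~ is_inversion f ->
  (forall v, n <= dist v (vmap f v))%N -> is_midpoint x ->
  n%:R <= mdist x (f x).
Proof.
move=> ninv fmin [u [v [uv xu xv]]].
have cx := midpoint_carried uv xu xv.
have xE w : mdist (f x) (vpt w) =
    ((dist w (vmap f u))%:R + (dist w (vmap f v))%:R) / 2.
  have -> : vpt w = f (vpt (vmap f^-1%g w)).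
    by rewrite isom_vpoint (isometry_VK (vmap_pair f)).
  rewrite isom_dist (mdist_adj _ uv cx) xu xv.
  rewrite -(dist_vmap f u) -(dist_vmap f v) !(isometry_VK (vmap_pair f)).
  rewrite (dist_sym _ w) (dist_sym _ w); lra.
have fuv : adj (vmap f u) (vmap f v) by rewrite adj_vmap.
have hu := metric_triangle (f x) x (vpt u).
have hv := metric_triangle (f x) x (vpt v).
rewrite !xE (mdist_adj _ uv cx) xu xv distxx (metric_sym (f x) x) in hu hv.
rewrite (mdist_adj _ uv cx) xu xv !distxx in hv.
rewrite (dist_sym v u) (dist_adj1 uv) in hu; rewrite (dist_adj1 uv) in hv.
have nu := fmin u; have nv := fmin v.
have nuR : n%:R <= (dist u (vmap f u))%:R :> R by rewrite ler_nat.
have nvR : n%:R <= (dist v (vmap f v))%:R :> R by rewrite ler_nat.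
case: (dist_step u fuv) => eu.
  rewrite (dist_sym u (vmap f v)) eu -natr1 (dist_sym _ u) in hu; lra.
case: (dist_step v fuv) => ev; last first.
  rewrite (dist_sym v (vmap f u)) ev -natr1 (dist_sym _ v) in hv; lra.
(* Now each of [u] and [v] is nearer to the image of the other than to its own, which forces the
   edge to be swapped. *)
have fp := four_point u (vmap f u) v (vmap f v).
rewrite dist_vmap (dist_adj1 uv) in fp.
have e1 := dist_sym (vmap f u) u; have e2 := dist_sym (vmap f v) u.
have e3 := dist_sym (vmap f v) v.
have fvu : vmap f v = u by apply: dist_eq0; lia.
have fuv' : vmap f u = v by apply: dist_eq0; lia.
by case: ninv; exists u, v; rewrite !isom_vpoint fvu fuv'.
Qed.

Lemma translation_length_vertex f : ~ is_inversion f -> exists v,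
  l f = (tstar_scale * dist v (vmap f v))%:R /\
  forall w, (dist v (vmap f v) <= dist w (vmap f w))%N.
Proof.
move=> ninv.
have [|v _ vmin] := @ex_minimizer _ (fun _ : T => True)
    (fun v => dist v (vmap f v)).
  by have [v] := tree_inhabited T; exists v.
exists v; split; last by move=> w; exact: vmin.
apply/eqP; rewrite eq_le translation_length_le/=.
apply: translation_length_geP => x; rewrite natrM tstar_distE => xV.
rewrite ler_wpM2l// ?ler0n//; case: xV => [[w ->]|[_ xm]].
  by rewrite isom_vpoint mdist_vpoint ler_nat; exact: vmin.
by apply: midpoint_displacement => // w; exact: vmin.
Qed.

Lemma translation_length_nat f : exists n, l f = n%:R.
Proof.
have [/translation_length_inversion ->|/translation_length_vertex[v [-> _]]] :=
  pselect (is_inversion f); [by exists 0%N|by eexists].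
Qed.

Lemma translation_length_neq0 f : l f <> 0 -> exists L,
  l f = (tstar_scale * L)%:R /\ translation (vmap f) (vmap f^-1%g) L.
Proof.
move=> lf; have ninv : ~ is_inversion f.
  by move=> /translation_length_inversion.
have [v [lv vmin]] := translation_length_vertex ninv.
exists (dist v (vmap f v)); split=> //.
have L0 : (0 < dist v (vmap f v))%N.
  by rewrite lt0n; apply/eqP => h; apply: lf; rewrite lv h muln0.
split=> //; [exact: vmap_pair|by exists v|].
apply: displacement_square (vmap_pair f) L0 vmin _ => w ww fw.
by apply: ninv; exists w, (vmap f w); rewrite !isom_vpoint fw.
Qed.

(** The square is taken because an inversion has length zero but need not fix a vertex of [T]. *)
Lemma translation_length_eq0 f : l f = 0 -> exists v, vmap (f * f)%g v = v.
Proof.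
have [[u [v [_ fu fv]]] _|/translation_length_vertex[v [-> _]]] :=
  pselect (is_inversion f).
  by exists u; apply: (@vpoint_inj R); rewrite -isom_vpoint /= fu fv.
move=> /eqP; rewrite pnatr_eq0 muln_eq0 (gtn_eqF tstar_scale_gt0) /=.
move=> /eqP/dist_eq0 vE; by exists v; rewrite vmap_mul -!vE.
Qed.

Lemma ping_pong_translation_length f g : l f <> 0 -> l g <> 0 ->
  l f <= l g -> l g - l f < l (f * g)%g -> l g - l f < l (f^-1 * g)%g ->
  ping_pong f g.
Proof.
move=> /translation_length_neq0[L [-> fL]] /translation_length_neq0[M [-> gM]].
rewrite ler_nat leq_pmul2l ?tstar_scale_gt0// => LM h1 h2.
have lt_of h v : (tstar_scale * M)%:R - (tstar_scale * L)%:R < l h ->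
    (M < L + dist v (vmap h v))%N.
  move=> /lt_le_trans/(_ (translation_length_le h v)).
  by rewrite ltrBlDr -natrD ltr_nat -mulnDr ltn_pmul2l ?tstar_scale_gt0// addnC.
have [||a [b [c [d e]]]] := schottky_edges_exist fL gM LM.
- move=> v; have := lt_of _ v h2.
  by rewrite -(dist_vmap f) -vmap_mul mulVKg.
(* The displacement of [f v] under [f * g] equals the distance from [f v] to the image of [v] under
   the inverse of [g]. *)
- move=> v; have := lt_of _ (vmap f v) h1.
  rewrite vmap_mul dist_vmap -(dist_vmap g^-1%g) (isometry_K (vmap_pair g)).
  by rewrite dist_sym.
by apply: ping_pong_edges; exact: e.
Qed.

End TranslationLengths.

(** * Generators and reduced words *)

Section Generation.
Local Open Scope classical_set_scope.
Local Open Scope group_scope.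
Context {gT : groupType}.
Implicit Types (S H : set gT) (x y g : gT).

Lemma sub_generated S : S `<=` generated S.
Proof. exact: sub_gen_smallest. Qed.

Lemma generated1 S : generated S 1.
Proof. by move=> H [[H1 _] _]; exact: set_mem H1. Qed.

Lemma generatedM S x y : generated S x -> generated S y -> generated S (x * y).
Proof.
move=> Sx Sy H [Hg SH]; apply: set_mem.
by apply: (group_closedM Hg); apply: mem_set; [exact: Sx|exact: Sy].
Qed.

Lemma generatedV S x : generated S x -> generated S x^-1.
Proof.
move=> Sx H [Hg SH]; apply: set_mem.
by apply: (group_closedV Hg); apply: mem_set; exact: Sx.
Qed.

Lemma generatedX S x n : generated S x -> generated S (x ^+ n).
Proof.
move=> Sx; elim: n => [|n IH]; first exact: generated1.
by rewrite expgS; exact: generatedM.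
Qed.

Lemma generated_min S H : S `<=` H -> H 1 ->
  (forall x y, H x -> H y -> H (x * y)) -> (forall x, H x -> H x^-1) ->
  generated S `<=` H.
Proof.
move=> SH H1 HM HV; apply: smallest_sub => //; split; first exact: mem_set.
move=> x y /set_mem Hx /set_mem Hy; apply: mem_set.
by apply: HM => //; exact: HV.
Qed.

Lemma generated_sub S S' : S `<=` generated S' -> generated S `<=` generated S'.
Proof.
by move=> SS'; apply: generated_min => //;
  [exact: generated1|exact: generatedM|exact: generatedV].
Qed.

Lemma generated_eq S S' : S `<=` generated S' -> S' `<=` generated S ->
  generated S = generated S'.
Proof. by move=> *; apply/seteqP; split; exact: generated_sub. Qed.

Lemma generatedl x y : generated [set x; y] x.
Proof. by apply: sub_generated; left. Qed.

Lemma generatedr x y : generated [set x; y] y.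
Proof. by apply: sub_generated; right. Qed.

Lemma generated_swap x y : generated [set x; y] = generated [set y; x].
Proof.
by congr generated; apply/seteqP; split=> z [->|->];
  [right|left|right|left].
Qed.

Lemma generated_mul x y : generated [set x; x * y] = generated [set x; y].
Proof.
apply: generated_eq => z [->|->]; try exact: generatedl.
  by apply: generatedM; [exact: generatedl|exact: generatedr].
have: generated [set x; x * y] (x^-1 * (x * y)); last by rewrite mulKg.
apply: generatedM; last exact: generatedr.
by apply: generatedV; exact: generatedl.
Qed.

Lemma generated_inv x y : generated [set x^-1; y] = generated [set x; y].
Proof.
apply: generated_eq => z [->|->]; try exact: generatedr.
  by apply: generatedV; exact: generatedl.
have: generated [set x^-1; y] x^-1^-1; last by rewrite invgK.
by apply: generatedV; exact: generatedl.
Qed.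

Lemma generated_mulV x y : generated [set x; x^-1 * y] = generated [set x; y].
Proof. by rewrite -(generated_inv x (_ * y)) generated_mul generated_inv. Qed.

(** Centralisers are subgroups: each generator commutes with the whole group, and hence so does each
    element. *)
Lemma generated_commute x y g h : x * y = y * x ->
  generated [set x; y] g -> generated [set x; y] h -> g * h = h * g.
Proof.
move=> xy Gg Gh.
have VC (a b : gT) : a * b = b * a -> a * b^-1 = b^-1 * a.
  by move=> ab; apply: (mulgI b); rewrite mulVKg mulgA -ab mulgK.
have cent (z : gT) : x * z = z * x -> y * z = z * y ->
    forall g', generated [set x; y] g' -> z * g' = g' * z.
  move=> xz yz g' Gg'.
  apply: (generated_min (H := [set t | z * t = t * z])) Gg'.
  - by move=> _ [->|->] /=.
  - by rewrite /= mulg1 mul1g.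
  - by move=> a b /= az bz; rewrite mulgA az -mulgA bz mulgA.
  - by move=> a /= az; exact: VC.
by apply: (cent g _ _ h Gh); apply/cent.
Qed.

End Generation.

(** * Reduced words and torsion in free groups *)

Section Words.
Local Open Scope classical_set_scope.
Local Open Scope group_scope.
Context {gT : groupType}.
Implicit Types (S : set gT) (x y g : gT).
Implicit Types (a b : bool * bool) (w s : seq (bool * bool)).

Definition letter_inv a := (a.1, ~~ a.2).

Lemma letter_val_inv x y a :
  letter_val x y (letter_inv a) = (letter_val x y a)^-1.
Proof. by case: a => [[] []]; rewrite /letter_val /= ?invgK. Qed.

Lemma word_val_cons x y a w :
  word_val x y (a :: w) = letter_val x y a * word_val x y w.
Proof. by rewrite /word_val big_cons. Qed.

Lemma word_val_nil x y : word_val x y [::] = 1.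
Proof. by rewrite /word_val big_nil. Qed.

Lemma word_val_cat x y w s :
  word_val x y (w ++ s) = word_val x y w * word_val x y s.
Proof. by rewrite /word_val big_cat. Qed.

(** The relation inside [reduced], named so that reduced words can be treated as paths. *)
Definition no_cancel a b := ~~ ((a.1 == b.1) && (a.2 != b.2)).

Lemma no_cancelPn a b : no_cancel a b = false -> b = letter_inv a.
Proof. by case: a b => [[] []] [[] []]. Qed.

Lemma no_cancelP a b : no_cancel a b -> b <> letter_inv a.
Proof. by case: a b => [[] []] [[] []]. Qed.

Lemma reduced_cons a w : reduced (a :: w) = path no_cancel a w.
Proof. by []. Qed.

Lemma reduced_behead a w : reduced (a :: w) -> reduced w.
Proof. exact: path_sorted. Qed.

Lemma reduced_letter_mul x y a w : reduced w -> exists2 s,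
  reduced s & word_val x y s = letter_val x y a * word_val x y w.
Proof.
case: w => [_|b w bw]; first by exists [:: a]; rewrite ?word_val_cons.
case ab: (no_cancel a b).
  by exists [:: a, b & w]; rewrite ?word_val_cons// reduced_cons /= ab.
exists w; first exact: reduced_behead bw.
by rewrite word_val_cons (no_cancelPn ab) letter_val_inv mulVKg.
Qed.

Lemma generated_letter x y a : generated [set x; y] (letter_val x y a).
Proof.
have l : generated [set x; y] x by exact: generatedl.
have r : generated [set x; y] y by exact: generatedr.
by case: a => [[] []]; rewrite /letter_val /= => //; exact: generatedV.
Qed.

Lemma generated_word x y w : generated [set x; y] (word_val x y w).
Proof.
elim: w => [|a w IH]; first by rewrite word_val_nil; exact: generated1.
by rewrite word_val_cons; apply: generatedM => //; exact: generated_letter.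
Qed.

Lemma generated_reduced x y g : generated [set x; y] g ->
  exists2 w, reduced w & word_val x y w = g.
Proof.
have word_ex : generated [set x; y] g -> exists w, word_val x y w = g.
  move: g; apply: generated_min => /=.
  - move=> _ [->|->].
      by exists [:: (false, false)]; rewrite word_val_cons word_val_nil mulg1.
    by exists [:: (true, false)]; rewrite word_val_cons word_val_nil mulg1.
  - by exists [::]; exact: word_val_nil.
  - by move=> _ _ [w <-] [s <-]; exists (w ++ s); exact: word_val_cat.
  - move=> _ [w <-]; elim: w => [|a w [s sE]].
      by exists [::]; rewrite word_val_nil invg1.
    exists (s ++ [:: letter_inv a]).
    rewrite word_val_cat sE !word_val_cons word_val_nil letter_val_inv mulg1.
    by rewrite invgM.
move=> /word_ex[w <-]; elim: w => [|a w [s rs sE]]; first by exists [::].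
by rewrite word_val_cons -sE; exact: reduced_letter_mul.
Qed.

Lemma path_flatten_nseq (e : rel (bool * bool)) a s n : path e a s ->
  e (last a s) a -> sorted e (flatten (nseq n (a :: s))).
Proof.
move=> as_ ea; case: n => //= n; rewrite cat_path as_ /=.
by elim: n => //= n IH; rewrite ea cat_path as_.
Qed.

Lemma word_val_flatten x y w n :
  word_val x y (flatten (nseq n w)) = word_val x y w ^+ n.
Proof.
elim: n => [|n IH]; first by rewrite word_val_nil.
by rewrite /= word_val_cat IH expgS.
Qed.

(* Either the powers of a word are reduced as written, or the word is conjugate
   to a shorter one. *)
Lemma reduced_torsion x y :
  (forall w s, reduced w -> reduced s -> word_val x y w = word_val x y s ->
    w = s) ->
  forall n w, (0 < n)%N -> reduced w -> word_val x y w ^+ n = 1 -> w = [::].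
Proof.
move=> uniq n w n0; elim: {w}(size w) {-2}w (leqnn (size w)) => [|k IH] w.
  by rewrite leqn0 => /nilP ->.
case: w => // a s sk rs wn.
case ea: (no_cancel (last a s) a).
  (* The word is cyclically reduced, so its power is a nonempty reduced word with the value of the
     empty one. *)
  have := uniq (flatten (nseq n (a :: s))) [::]; rewrite word_val_flatten wn.
  rewrite word_val_nil => H; have : flatten (nseq n (a :: s)) = [::].
    by apply: H => //; exact: path_flatten_nseq.
  by case: (n) n0.
case/lastP: s sk rs wn ea => [|s b] sk rs wn ea.
  by move: ea; rewrite /no_cancel /= !eqxx.
rewrite last_rcons in ea.
have aE := no_cancelPn ea.
have bE : b = letter_inv a by rewrite aE; case: (b) => [? []].
have rs' : reduced s.
  by move: (reduced_behead rs); rewrite /reduced -cats1 => /cat_sorted2[].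
(* The word is the conjugate of [s] by [a], so the same power of [s] is trivial. Once [s] is empty,
   [a] and [b] cancel, against reducedness. *)
have : s = [::].
  apply: IH => //; first by move: sk; rewrite /= size_rcons; lia.
  move: wn; rewrite word_val_cons -cats1 word_val_cat word_val_cons.
  rewrite word_val_nil mulg1 bE letter_val_inv mulgA.
  have conjX (u v : gT) : (u * v * u^-1) ^+ n = u * v ^+ n * u^-1.
    elim: (n) => [|m IHm]; first by rewrite !expg0 mulg1 mulgV.
    by rewrite !expgS IHm !mulgA mulgVK.
  rewrite conjX => h; apply: (mulgI (letter_val x y a)).
  by apply: (mulIg (letter_val x y a)^-1); rewrite h mulg1 mulgV.
move=> sE; move: rs; rewrite sE /= bE /no_cancel /= eqxx.
by case: (a) => [? []].
Qed.

Lemma free_torsion S g n : free_of_rank_two (generated S) -> generated S g ->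
  (0 < n)%N -> g ^+ n = 1 -> g = 1.
Proof.
move=> [x [y [Sx Sy free]]] Sg n0 gn.
have Sxy h : generated [set x; y] h -> generated S h.
  by apply: generated_sub => _ [->|->].
have uniq w s : reduced w -> reduced s -> word_val x y w = word_val x y s ->
    w = s.
  move=> rw rs ws; have Sw : generated S (word_val x y w).
    by apply: Sxy; exact: generated_word.
  have [t [_ tu]] := free _ Sw.
  by rewrite -(tu w) // -(tu s).
have [w [[rw wg] _]] := free g Sg.
by rewrite -wg (reduced_torsion uniq n0 rw) ?word_val_nil// wg.
Qed.

Lemma free_noncommuting S : free_of_rank_two (generated S) ->
  ~ forall g h, generated S g -> generated S h -> g * h = h * g.
Proof.
move=> [x [y [Sx Sy free]]] comm.
have Sxy : generated S (x * y) by exact: generatedM.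
have [w [_ wu]] := free _ Sxy.
have e1 : w = [:: (false, false); (true, false)].
  by apply: wu; split=> //; rewrite !word_val_cons word_val_nil mulg1.
have e2 : w = [:: (true, false); (false, false)].
  by apply: wu; split=> //; rewrite !word_val_cons word_val_nil mulg1 comm.
by rewrite e1 in e2.
Qed.

End Words.

(** * Discrete and free groups *)

Section PingPongLemma.
Local Open Scope classical_set_scope.
Local Open Scope ring_scope.
Context {R : realType} {T : simplicial_tree}.
Local Notation X := (realization R T).
Implicit Types (f g h : isom R T) (x : X) (a b : bool * bool).

Lemma isom_continuous f : continuous f.
Proof.
move=> x A /nbhs_ballP[e e0 eA]; apply/nbhs_ballP; exists e => // y.
rewrite ballEmdist /= => xy; apply: eA.
by rewrite ballEmdist /= isom_dist.
Qed.

Lemma eval_continuous x : continuous (fun f : isom R T => f x).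
Proof.
move=> f; apply: (@continuous_comp _ _ _
  (fun f => (f : X -> X) : {ptws X -> X}) (fun u : {ptws X -> X} => u x)).
  exact: initial_continuous.
exact: (@proj_continuous X (fun=> X) x).
Qed.

(** Indexing the four sets by letters turns the four inclusions into one rule. The base point [o]
    comes from the failure to cover. *)
Lemma ping_pong_witness f g : ping_pong f g ->
  exists (U : bool * bool -> set X) (o : X),
  [/\ forall a, closed (U a), forall a, ~ U a o,
      forall a b x, U a x -> U b x -> a = b &
      forall a x, ~ U (letter_inv a) x -> U a (letter_val f g a x)].
Proof.
move=> [Up [Um [Vp [Vm [_ [c1 c2 c3 c4] [[d1 d2 d3] [d4 d5 d6]] cov]]]]].
move=> [m1 m2 m3 m4].
pose U a := if a.1 then (if a.2 then Vm else Vp) else (if a.2 then Um else Up).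
have [ o Uo] : exists o, ~ (Up `|` Um `|` Vp `|` Vm) o.
  apply: contrapT => h; apply: cov; apply/seteqP; split=> // x _.
  by apply: contrapT => hx; apply: h; exists x.
exists U, o; split.
- by case=> [[] []].
- by move=> a Ua; apply: Uo; case: a Ua => [[] []] /=; rewrite /U /=; tauto.
- have disj (A B : set X) x : A `&` B = set0 -> A x -> B x -> False.
    by move=> AB Ax Bx; have : (A `&` B) x by []; rewrite AB.
  by case=> [[] []] [[] []] x; rewrite /U /= => // p q; exfalso;
    first [exact: (disj _ _ x _ p q)|exact: (disj _ _ x _ q p)].
- case=> [[] []] x; rewrite /U /letter_val /= => h.
  + by apply: m4; exists x.
  + by apply: m3; exists x.
  + by apply: m2; exists x.
  + by apply: m1; exists x.
Qed.

Section Witness.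
Variables (f g : isom R T) (U : bool * bool -> set X) (o : X).
Hypotheses (Uo : forall a, ~ U a o)
  (Udisj : forall a b x, U a x -> U b x -> a = b)
  (Ustep : forall a x, ~ U (letter_inv a) x -> U a (letter_val f g a x)).

(** Letters act from the right. Since neighbours do not cancel, each one finds the point outside the
    set of its inverse and sends it into its own set. *)
Lemma word_target a w : reduced (a :: w) -> U a (word_val f g (a :: w) o).
Proof.
elim: w a => [|b w IH] a rw; rewrite word_val_cons /=; apply: Ustep.
  by rewrite word_val_nil; exact: Uo.
move=> Ub; have := IH b (reduced_behead rw) => /(Udisj Ub) ab.
by move: rw; rewrite reduced_cons /= => /andP[/no_cancelP/(_ (esym ab))].
Qed.

Lemma reduced_injective w s : reduced w -> reduced s ->
  word_val f g w = word_val f g s -> w = s.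
Proof.
elim: w s => [|a w IH] [|b s] // rw rs ws.
- by have := word_target rs; rewrite -ws word_val_nil => /Uo.
- by have := word_target rw; rewrite ws word_val_nil => /Uo.
have ab : a = b.
  by have := word_target rw; rewrite ws => /Udisj; apply; exact: word_target.
subst b; congr cons; apply: IH (reduced_behead rw) (reduced_behead rs) _.
by move: ws; rewrite !word_val_cons => /mulgI.
Qed.

End Witness.

Lemma ping_pong_free f g : ping_pong f g ->
  free_of_rank_two (generated [set f; g]%classic).
Proof.
move=> /ping_pong_witness[U [ o [_ Uo Udisj Ustep]]].
exists f, g; split; [exact: generatedl|exact: generatedr|move=> h].
move=> /generated_reduced[w rw wh]; exists w; split=> // s [rs sh].
by apply: (reduced_injective Uo Udisj Ustep) => //; rewrite wh.
Qed.

(* An element moving the base point close to its image under [h] differs from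
   [h] by a word keeping the base point out of the ping-pong sets. *)
Lemma ping_pong_discrete f g : ping_pong f g ->
  is_discrete (generated [set f; g]%classic).
Proof.
move=> /ping_pong_witness[U [ o [Uc Uo Udisj Ustep]]] A.
set G := generated _; rewrite openE => p Ap.
pose h := set_val p.
pose C := \bigcup_(a in [set: bool * bool]) U a.
have Cc : closed C.
  by apply: closed_bigcup => [|a _]; [exact: finite_finset|exact: Uc].
(* [W] is open because [C] is closed and evaluation at [o] is continuous; it will isolate [h] in the
   group. *)
pose W := [set k : isom R T | ~ C ((h^-1)%g (k o))].
have Wo : open W.
  have -> : W = (fun k : isom R T => (h^-1)%g (k o)) @^-1` (~` C) by [].
  apply: open_comp; last exact: closed_openC.
  move=> k _; apply: (@continuous_comp _ _ _ (fun k : isom R T => k o) (h^-1)%g).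
    exact: eval_continuous.
  exact: isom_continuous.
have VWo : open (set_val @^-1` W : set (set_type G)) by exists W.
exists (set_val @^-1` W); split=> [//||].
  have hK : isom_inv h (set_val p o) = o := isom_funK h o.
  have : ~ C o by move=> [a _ /Uo].
  by rewrite -{1}hK.
move=> q; rewrite /W /= => qW; suff -> : q = p by [].
apply: val_inj => /=.
have Gq : G (h^-1 * set_val q)%g.
  apply: generatedM; last exact: set_valP.
  by apply: generatedV; exact: set_valP.
have [[|a w] rw wE] := generated_reduced Gq.
  by apply: (mulgI h^-1%g); rewrite -wE word_val_nil mulVg.
have := word_target Uo Udisj Ustep rw; rewrite wE => Ua.
by case: qW; exists a.
Qed.

End PingPongLemma.

(** * Elliptic elements of discrete groups *)

Section DiscreteElliptic.
Local Open Scope classical_set_scope.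
Local Open Scope ring_scope.
Context {R : realType} {T : simplicial_tree}.
Local Notation X := (realization R T).
Implicit Types (f g h : isom R T) (x : X) (u v : T).

Lemma finite_ball v n : locally_finite T ->
  finite_set [set u | (dist v u <= n)%N].
Proof.
move=> Tlf; elim: n => [|n IH].
  apply: (@sub_finite_set _ _ [set v]); last exact: finite_set1.
  by move=> u /=; rewrite leqn0 => /eqP/dist_eq0.
apply: (@sub_finite_set _ _ ([set u | (dist v u <= n)%N] `|`
  \bigcup_(w in [set u | (dist v u <= n)%N]) [set u | adj w u])).
  move=> u /=; rewrite leq_eqVlt => /orP[/eqP vu|]; last by left.
  have [|w w1 w2] := @dist_between _ v u n; first lia.
  right; exists w => /=; first by rewrite w1.
  by rewrite -dist_adj w2 vu; apply/eqP; lia.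
by rewrite finite_setU; split=> //; apply: bigcup_finite.
Qed.

Lemma vmapX_fixed f v n : vmap f v = v -> vmap (f ^+ n)%g v = v.
Proof.
move=> fv; elim: n => [|n IH]; first exact: vmap1.
by rewrite expgS vmap_mul IH.
Qed.

(** The orbit of [v] stays in a ball around [p], which is finite; without such a power the iterates
    of [v] would be pairwise distinct. *)
Lemma fixed_power f p v : locally_finite T -> vmap f p = p ->
  exists2 n, (0 < n)%N & vmap (f ^+ n)%g v = v.
Proof.
move=> Tlf fp; pose F n := vmap (f ^+ n)%g v.
apply: contrapT => h; apply: infinite_nat.
have FB : F @^-1` [set u | (dist p u <= dist p v)%N] = setT.
  apply/seteqP; split=> // n _ /=.
  by rewrite /F -{1}(vmapX_fixed n fp) dist_vmap.
rewrite -FB; apply: finite_preimage; last exact: finite_ball.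
have lt_inj i j : (i < j)%N -> F i <> F j.
  move=> ij FE; apply: h; exists (j - i)%N; first by rewrite subn_gt0.
  rewrite -[LHS](isometry_K (vmap_pair (f ^+ i)%g)).
  rewrite -(vmap_mul (f ^+ i)%g) -expgnDr.
  by rewrite (subnKC (ltnW ij)) -/(F j) -FE (isometry_K (vmap_pair _)).
by move=> i j _ _ FE; case: (ltngtP i j) => // /lt_inj []; rewrite FE.
Qed.

(** Factorials are eventually divisible by any given period, so the factorial powers of [f] converge
    pointwise to the identity, although the periods may be unbounded. *)
Lemma fact_power_fixes f p x : locally_finite T -> vmap f p = p ->
  exists N, forall n, (N <= n)%N -> (f ^+ n`!)%g x = x.
Proof.
move=> Tlf fp.
have fix_v v : exists N, forall n, (N <= n)%N -> vmap (f ^+ n`!)%g v = v.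
  have [k k0 fk] := fixed_power v Tlf fp; exists k => n kn.
  have /dvdnP[q ->] : (k %| n`!)%N by rewrite dvdn_fact// k0.
  by rewrite mulnC expgnA; exact: vmapX_fixed.
case: (point_cases x) => [[v ->]|[u [v [uv cx]]]].
  by have [N Nv] := fix_v v; exists N => n /Nv; rewrite isom_vpoint => ->.
have [N Nu] := fix_v u; have [M Mv] := fix_v v; exists (maxn N M) => n.
rewrite geq_max => /andP[/Nu fu /Mv fv]; exact: isom_fix_edge uv cx fu fv.
Qed.

Lemma discrete_elliptic (S : set (isom R T)) f p : locally_finite T ->
  is_discrete (generated S) -> generated S f -> vmap f p = p ->
  exists2 n, (0 < n)%N & (f ^+ n)%g = 1%g.
Proof.
move=> Tlf disc Sf fp.
(* Discreteness isolates the identity by an open set [W], which the factorial powers of [f]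
   eventually enter. *)
have [W [Wo W1]] : exists W : set (isom R T), open W /\
    forall h, generated S h -> W h <-> h = 1%g.
  have S1 : generated S 1%g by exact: generated1.
  have [W Wo WE] := disc [set SigSub (mem_set S1)].
  exists W; split=> // h Sh.
  have := congr1 (fun A : set _ => A (SigSub (mem_set Sh))) WE.
  rewrite /preimage /= => ->; split=> [/(congr1 val)//|h1].
  by apply: val_inj.
case: Wo => A Ao AW.
pose phi h : {ptws X -> X} := (h : X -> X).
have cvg1 : (fun n => phi (f ^+ n`!)%g) @ \oo --> phi 1%g.
  apply/pointwise_cvgP => x; apply: cvg_near_cst.
  have [N Nx] := fact_power_fixes x Tlf fp.
  by exists N => // n /= /Nx.
have A1 : A (phi 1%g).
  have : W 1%g by apply/W1 => //; exact: generated1.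
  by rewrite -AW.
have [N _ NA] : \forall n \near \oo, A (phi (f ^+ n`!)%g).
  by apply: cvg1; exact: open_nbhs_nbhs.
exists N`!; first exact: fact_gt0.
apply/W1; first exact: generatedX.
by rewrite -AW; apply: (NA N) => /=.
Qed.

Lemma discrete_free_elliptic (S : set (isom R T)) f : locally_finite T ->
  is_discrete (generated S) -> free_of_rank_two (generated S) ->
  generated S f -> translation_length f = 0 -> f = 1%g.
Proof.
move=> Tlf disc free Sf /translation_length_eq0[p fp].
have Sff : generated S (f * f)%g by exact: generatedM.
have [n n0 fn] := discrete_elliptic Tlf disc Sff fp.
apply: (@free_torsion _ S f (2 * n)) => //; first by rewrite muln_gt0.
by rewrite expgnA expg2.
Qed.

End DiscreteElliptic.

(** * Runs of the procedure *)

Section ProcedureInvariant.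
Local Open Scope classical_set_scope.
Context {R : realType} {gT : groupType} (l : gT -> R) (N : gT -> nat).
Hypothesis lN : forall g, l g = (N g)%:R%R.
Implicit Types (G : set gT) (s t : @state R gT) (X Y Z : gT) (m : R).

Definition least_length X Y := Num.min (l (X * Y)%g) (l (X^-1 * Y)%g).

Definition hyperbolic_generators G X Y :=
  [/\ generated [set X; Y] = G, l X <> 0%R & l Y <> 0%R].

(** What a run that returns false has established. *)
Definition degenerate G := exists X Y, generated [set X; Y] = G /\
  [\/ l X = 0%R, l Y = 0%R, l (X * Y)%g = 0%R | l (X^-1 * Y)%g = 0%R].

Definition long_products G X Y := [/\ hyperbolic_generators G X Y,
  (l X <= l Y)%R & (l Y - l X < least_length X Y)%R].

Definition invariant G s := match s with
  | Step1 X Y => generated [set X; Y] = G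
  | Step2 X Y => hyperbolic_generators G X Y
  | Step3 X Y => hyperbolic_generators G X Y /\ (l X <= l Y)%R
  | Step4 X Y m =>
    [/\ hyperbolic_generators G X Y, (l X <= l Y)%R & m = least_length X Y]
  | Step5 X Y m =>
    [/\ hyperbolic_generators G X Y, (l X <= l Y)%R, m = least_length X Y
      & m <> 0%R]
  | Step6 X Y => long_products G X Y
  | ReturnFalse => degenerate G
  | ReturnTrue X Y => long_products G X Y
  end.

Lemma next_invariant G s t : Defs.next l s t -> invariant G s -> invariant G t.
Proof.
case=> {s t} /=.
- move=> X Y XY0 XYG; exists X, Y; split=> //.
  by case: XY0; [exact: Or41|exact: Or42].
- by move=> X Y XY0 XYG; split=> // h; apply: XY0; tauto.
- move=> X Y YX [XYG X0 Y0]; split; last exact: ltW.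
  by split=> //; rewrite generated_swap.
- by move=> X Y /negP; rewrite -leNgt.
- by move=> X Y [].
- move=> X Y m m0 [[XYG X0 Y0] XY mE]; exists X, Y; split=> //.
  move: m0; rewrite mE /least_length minEle.
  by case: ifP => _; [exact: Or43|exact: Or44].
- by move=> X Y m m0 [].
- move=> X Y m Z _ ZE lZ [[XYG X0 Y0] _ _ m0]; split=> //; last by rewrite lZ.
  by case: ZE => ->; rewrite ?generated_mul ?generated_mulV.
- move=> X Y m /negP; rewrite -ltNge => h [XYG XY mE _].
  by split; rewrite -?mE.
- by move=> X Y.
Qed.

(** The weight 8 lets a unit drop in total length outweigh the return from step 5 to step 2, which
    raises the constant from 3 to 6. *)
Definition state_measure s : nat := match s with
  | Step1 X Y => 8 * (N X + N Y) + 7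
  | Step2 X Y => 8 * (N X + N Y) + 6
  | Step3 X Y => 8 * (N X + N Y) + 5
  | Step4 X Y _ => 8 * (N X + N Y) + 4
  | Step5 X Y _ => 8 * (N X + N Y) + 3
  | Step6 X Y => 8 * (N X + N Y) + 2
  | ReturnFalse => 0
  | ReturnTrue X Y => 0
  end.

Lemma next_measure G s t : Defs.next l s t -> invariant G s ->
  state_measure t < state_measure s.
Proof.
case=> {s t} /=; try by move=> *; lia.
move=> X Y m Z mXY _ lZ [[_ X0 _] _ _ _].
have N0 : N X != 0 by apply/eqP => e; apply: X0; rewrite lN e.
(* The new length is at most [l Y - l X], so the total drops by at least [l X], which is
   positive. *)
move: mXY; rewrite -lZ !lN lerBrDr -natrD ler_nat; lia.
Qed.

Lemma invariant_terminates G s : invariant G s -> terminates l s.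
Proof.
move=> sG run run0 runS.
have runG n : invariant G (run n).
  by elim: n => [|n IH]; [rewrite run0|exact: next_invariant (runS n) IH].
have bound n : state_measure (run n) + n <= state_measure s.
  elim: n => [|n IH]; first by rewrite run0 addn0.
  by have := next_measure (runS n) (runG n); lia.
by have := bound (state_measure s).+1; lia.
Qed.

Lemma invariant_final G s t : invariant G s -> final_state l s t ->
  (t = ReturnFalse /\ degenerate G) \/
  exists X Y, t = ReturnTrue X Y /\ long_products G X Y.
Proof.
move=> sG [st stop]; have {sG} : invariant G t.
  elim: st sG => // {s t stop} [s t|s t u _ IH1 _ IH2 /IH1/IH2]//.
  exact: next_invariant.
case: t stop {st s} => /=.
- move=> X Y []; have [XY|XY] := pselect (l X = 0%R \/ l Y = 0%R).
    by eexists; exact: next1_false.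
  by eexists; exact: next1.
- move=> X Y []; have [XY|XY] := pselect (l X > l Y)%R.
    by eexists; exact: next2_swap.
  by eexists; exact: next2.
- by move=> X Y []; eexists; exact: next3.
- move=> X Y m []; have [m0|m0] := pselect (m = 0%R).
    by eexists; exact: next4_false.
  by eexists; exact: next4.
- move=> X Y m stop [_ _ mE _]; case: stop.
  have [mXY|mXY] := pselect (m <= l Y - l X)%R; last first.
    by eexists; exact: next5.
  (* Step 5 is never stuck, because one of the two products attains [m]. *)
  move: mE; rewrite /least_length minEle; case: ifP => _ mE.
    by eexists; apply: (next5_replace mXY (Z := (X * Y)%g)) => //; left.
  by eexists; apply: (next5_replace mXY (Z := (X^-1 * Y)%g)) => //; right.
- by move=> X Y []; eexists; exact: next6.
- by left.
- by move=> X Y _ XYG; right; exists X, Y.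
Qed.

End ProcedureInvariant.

(** In each of the four cases the element of length zero is trivial, so one generator is trivial or
    a power of the other, and the generators commute. *)
Lemma degenerate_not_discrete_free (R : realType) (T : simplicial_tree)
    (G : set (isom R T)) : locally_finite T ->
  degenerate (@translation_length R T) G ->
  ~ (is_discrete G /\ free_of_rank_two G).
Proof.
move=> Tlf [X [Y [<- lXY]]] [disc free].
have trivial g := @discrete_free_elliptic R T _ g Tlf disc free.
have GX : generated [set X; Y]%classic X by exact: generatedl.
have GY : generated [set X; Y]%classic Y by exact: generatedr.
apply: (free_noncommuting free) => g h; apply: generated_commute.
case: lXY => /trivial h1.
- by rewrite h1// mulg1 mul1g.
- by rewrite h1// mulg1 mul1g.
- have XY : (X * Y = 1)%g by apply: h1; exact: generatedM.
  by rewrite XY -(mulKg X Y) XY mulg1 mulVg.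
- have XY : (X^-1 * Y = 1)%g.
    by apply: h1; apply: generatedM => //; exact: generatedV.
  by rewrite -(mulVKg X Y) XY mulg1.
Qed.

Local Open Scope classical_set_scope.

Theorem theorem5p3 (R : realType) (T : simplicial_tree)
    (T_lf : locally_finite T) (A B : isom R T) :
  let G := generated [set A; B] in
  let l := @translation_length R T in
  terminates l (Step1 A B) /\
  (forall s, final_state l (Step1 A B) s ->
    (is_discrete G /\ free_of_rank_two G ->
      exists X Y, [/\ s = ReturnTrue X Y, generated [set X; Y] = G &
                      ping_pong X Y]) /\
    (~ (is_discrete G /\ free_of_rank_two G) -> s = ReturnFalse)).
Proof.
move=> G l.
have /choice[N lN] := @translation_length_nat R T.
have start : invariant l G (Step1 A B) by [].
split=> [|s sfin]; first exact: invariant_terminates lN _ _ start.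
case: (invariant_final start sfin) => [[-> degG]|[X [Y [-> XYG]]]].
  by split=> // /(degenerate_not_discrete_free T_lf degG).
case: XYG => -[XYG X0 Y0] XY; rewrite lt_min => /andP[h1 h2].
have pp : ping_pong X Y by exact: ping_pong_translation_length.
(* A ping-pong pair makes the group discrete and free, so returning true is impossible when it is
   not both. *)
split=> [_|[]]; first by exists X, Y.
by rewrite -XYG; split; [exact: ping_pong_discrete|exact: ping_pong_free].
Qed.
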